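(* Let $n\ge2$ be an integer and $E$ a finite linearly ordered set of cardinality $n$. For every normal monomial $m\in\mathrm{NM}_{\mathrm{ss}}(E)$, the rewriting of $g_E m$ is either a single normal monomial (with coefficient $1$) or zero. Let $g_n(-)$ be the induced map from $\mathcal{I}_n$ to $\mathcal{I}_n\sqcup\{\mathbf{0}\}$ (defined in the context). For every inversion sequence $e\in\mathcal{I}_n$, $g_n(e)$ is computed inductively as follows, where in each case $g_n(e)=\mathbf{0}$ whenever the value $g_{n-1}(\tilde e)$ or $g_{k-1}(\tilde e)$ used there is $\mathbf{0}$: 1. If $e_i\neq0$ for all $i\ge2$, set $\tilde e_i=e_{i+1}-1$ for $1\le i\le n-1$. Then $g_n(e)_1=0$ and $g_n(e)_k=(g_{n-1}(\tilde e))_{k-1}+1$ for all $2\le k\le n$. 2. If $e_n=0$, then $g_n(e)_1=0$ and $g_n(e)_k=e_{k-1}+1$ for all $2\le k\le n$. 3. If $e$ has a zero at some index $\geq 2$ and the maximal index $k$ with $e_k=0$ satisfies $k<n$, set $\tilde e=(e_i)_{1\le i\le k-1}$. Then $g_n(e)_j=g_{k-1}(\tilde e)_j$ for all $1\le j\le k-1$ and $g_n(e)_j=e_j$ for all $k\le j\le n$.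
   Context: Chow ring and generators: for a finite linearly ordered set $E$, $\underline{\mathrm{CH}}(\mathrm{B}_E)=\mathbb{Q}[x_F,\ \emptyset\ne F\subset E]/(\mathcal{I}+\mathcal{J})$, where $\mathcal{I}$ is generated by $\sum_{F\ni i}x_F$ for $i\in E$, and $\mathcal{J}$ by the products $x_{F_1}x_{F_2}$ for inclusion-incomparable nonempty $F_1,F_2\subset E$. For nonempty $F\subset E$, $g_F=\sum_{S\subset E,\ S\subset\{i\,\mid\, i>\max F\}}x_{F\cup S}\in\underline{\mathrm{CH}}(\mathrm{B}_E)$. Normal monomials: for nonempty subsets $I\subset J$ of $E$, $I$ is an initial segment of $J$ if $I=J\cap\{i\in E\mid i\le\max I\}$. For commuting variables $h_S$ indexed by subsets $S\subset E$ with at least two elements, a quadratic monomial is normal if it can be written $h_{S_1}h_{S_2}$ where, with $S=S_1\cup S_2$: (i) $\mathrm{Card}(S_1),\mathrm{Card}(S_2)\ge2$; (ii) $S_1$ is an initial segment of $S$ and is the minimal initial segment $I$ of $S$ with $I\cup S_2=S$; (iii) $\mathrm{Card}(S\setminus S_2)\ge2$ unless $S_2=S\setminus\{\max S\}$. A monomial is normal if all its quadratic submonomials are normal; $\mathrm{NM}(E)$ is the set of normal monomials. $\mathrm{NM}_{\mathrm{ss}}(E)$ is the set of monomials in the $g_S$ obtained from $\mathrm{NM}(E)$ by replacing each $h_S$ by $g_S$, and $f:\mathrm{NM}(E)\to\mathrm{NM}_{\mathrm{ss}}(E)$ is the bijection replacing $h$ by $g$. The monomials of $\mathrm{NM}_{\mathrm{ss}}(E)$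 are the normal monomials of a Gröbner basis of the ideal of relations between the $g_S$ ($\mathrm{Card}(S)\ge2$), so their classes form a $\mathbb{Q}$-basis of $\underline{\mathrm{CH}}(\mathrm{B}_E)$. The rewriting of a polynomial in the $g_S$ is the unique $\mathbb{Q}$-linear combination of elements of $\mathrm{NM}_{\mathrm{ss}}(E)$ equal to it in $\underline{\mathrm{CH}}(\mathrm{B}_E)$. Permutations and inversion sequences: $\mathbb{S}_E$ is the set of bijections $\sigma:[n]\to E$, $n=\mathrm{Card}(E)$, $[n]=\{1,\dots,n\}$. $\mathrm{Des}(\sigma)=\{i\in[n-1]\mid\sigma(i)>\sigma(i+1)\}$, and $S(\sigma,i)=\{\sigma(j)\mid j\ge i,\ \sigma(j)\le\sigma(i)\}$. The map $\Psi:\mathbb{S}_E\to\mathrm{NM}(E)$, $\Psi(\sigma)=\prod_{i\in\mathrm{Des}(\sigma)}h_{S(\sigma,i)}$, is a bijection. $\mathcal{I}_n$ is the set of $n$-inversion sequences, i.e. integer sequences $(e_i)_{1\le i\le n}$ with $0\le e_i\le i-1$. Lehmer's code is the bijection $\mathrm{L}:\mathbb{S}_E\to\mathcal{I}_n$, $\mathrm{L}(\sigma)_i=\mathrm{Card}\{j<i\mid\sigma(j)>\sigma(i)\}$. The map $g_n$: for $e\in\mathcal{I}_n$, let $m=f(\Psi(\mathrm{L}^{-1}(e)))\in\mathrm{NM}_{\mathrm{ss}}(E)$. If the rewriting of $g_Em$ is zero, put $g_n(e)=\mathbf{0}$ (a formal symbol); if it is a normal monomial $m'$, put $g_n(e)=\mathrm{L}(\Psi^{-1}(f^{-1}(m')))\in\mathcal{I}_n$.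 This depends only on $n=\mathrm{Card}(E)$. For $n=1$, $\mathcal{I}_1=\{(0)\}$ and $g_1((0))=\mathbf{0}$ (since $g_E=x_E=0$ in $\underline{\mathrm{CH}}(\mathrm{B}_E)$ when $\mathrm{Card}(E)=1$). *)

(* Defs.v *)
From HB Require Import structures.
From mathcomp Require Import all_boot all_order all_algebra.
From mathcomp Require Import mpoly boolp.
From Stdlib Require Import ClassicalEpsilon.

Set Implicit Arguments.
Unset Strict Implicit.
Unset Printing Implicit Defensive.

Import Order.TTheory GRing.Theory.
Local Open Scope ring_scope.
Local Open Scope quotient_scope.

(* Polynomial variables are numbered by 'I_#|_|; the variable of index u : xidx E
   (resp. hidx E) is the one numbered enum_rank u. *)
Notation xidx E := {F : {set E} | F != set0}.
Notation hidx E := {S : {set E} | 2 <= #|S|}%N.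
Notation xpoly E := {mpoly rat[#|{: xidx E}|]}.
Notation hmonomial E := 'X_{1..#|{: hidx E}|}.
Notation hpoly E := {mpoly rat[#|{: hidx E}|]}.

Section ChowRing.
Variable E : finType.

(* x_F for nonempty F; the junk value 0 at F = set0 is never used. *)
Definition xvar (F : {set E}) : xpoly E :=
  if insub F is Some u then 'X_(enum_rank (u : xidx E)) else 0.

Definition incomparable (F G : {set E}) : bool :=
  ~~ (F \subset G) && ~~ (G \subset F).

(* p lies in I + J: it is a polynomial combination of the (finitely many)
   generators of I and J. *)
Definition in_chow_ideal (p : xpoly E) : Prop :=
  exists (a : E -> xpoly E) (b : {set E} -> {set E} -> xpoly E),
    p = \sum_(i : E) a i * (\sum_(F : {set E} | i \in F) xvar F)
      + \sum_(F : {set E} | F != set0)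
          \sum_(G : {set E} | (G != set0) && incomparable F G)
             b F G * (xvar F * xvar G).

Definition chow_ideal : {pred xpoly E} := [pred p | `[< in_chow_ideal p >]].

Lemma chow_ideal_closed : idealr_closed (chow_ideal : {pred xpoly E}).
Proof.
split.
- apply/asboolP; exists (fun=> 0), (fun _ _ => 0).
  rewrite !big1 ?addr0 // => [F _|i _]; last by rewrite mul0r.
  by rewrite big1 // => G _; rewrite mul0r.
- apply/asboolP => -[a [b /(congr1 (meval (fun=> 0)))]].
  have x0 F : meval (fun=> 0) (xvar F) = 0 :> rat.
    by rewrite /xvar; case: insubP => [u _ _|_]; rewrite ?mevalXU ?meval0.
  rewrite meval1 mevalD !raddf_sum !big1 ?addr0 /= => [/eqP|F _|i _].
  + by rewrite oner_eq0.
  + rewrite raddf_sum big1 // => G _ /=.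
    by rewrite !mevalM !x0 mul0r mulr0.
  + by rewrite mevalM (raddf_sum (meval _)) big1 ?mulr0 // => F _; apply: x0.
- move=> c _ _ /asboolP[a [b ->]] /asboolP[a' [b' ->]]; apply/asboolP.
  exists (fun i => c * a i + a' i), (fun F G => c * b F G + b' F G).
  rewrite mulrDr addrACA !mulr_sumr -!big_split; congr (_ + _).
  + by apply: eq_bigr => i _; rewrite mulrDl mulrA.
  + apply: eq_bigr => F _; rewrite mulr_sumr -big_split.
    by apply: eq_bigr => G _ /=; rewrite [RHS]mulrDl !mulrA.
Qed.

HB.instance Definition _ :=
  isIdealr.Build (xpoly E) chow_ideal chow_ideal_closed.

Definition chow : comNzRingType := {ideal_quot chow_ideal}.

Definition chow_class (p : xpoly E) : chow := \pi_{ideal_quot chow_ideal} p.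

Lemma chow_class_is_zmod_morphism : zmod_morphism chow_class.
Proof. exact: (rmorphB \pi_{ideal_quot chow_ideal}). Qed.

Lemma chow_class_is_monoid_morphism : monoid_morphism chow_class.
Proof.
split; first exact: (rmorph1 \pi_{ideal_quot chow_ideal}).
exact: (rmorphM \pi_{ideal_quot chow_ideal}).
Qed.

HB.instance Definition _ :=
  GRing.isZmodMorphism.Build (xpoly E) chow chow_class
    chow_class_is_zmod_morphism.
HB.instance Definition _ :=
  GRing.isMonoidMorphism.Build (xpoly E) chow chow_class
    chow_class_is_monoid_morphism.

End ChowRing.

Section NormalMonomials.
Context {d : Order.disp_t} {E : finOrderType d}.
Implicit Types (I J F S : {set E}) (m : hmonomial E).

Definition is_max F (i : E) : bool :=
  (i \in F) && [forall j in F, j <= i]%O.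

(* {i | i > max F} *)
Definition above_max F : {set E} :=
  [set i | [exists j, is_max F j && (j < i)%O]].

Definition chow_g F : chow E :=
  chow_class (\sum_(S : {set E} | S \subset above_max F) xvar (F :|: S)).

Definition initial_segment I J : bool :=
  [&& I != set0, I \subset J &
      I == J :&: [set i | [exists j, is_max I j && (i <= j)%O]]].

(* Initial segments of S are totally ordered by inclusion, so "minimal" is
   inclusion in every competitor. *)
Definition normal_pair S1 S2 : bool :=
  let S := S1 :|: S2 in
  [&& (2 <= #|S1|)%N && (2 <= #|S2|)%N,
      initial_segment S1 S,
      [forall I : {set E},
         initial_segment I S && (I :|: S2 == S) ==> (S1 \subset I)] &
      (2 <= #|S :\: S2|)%N || (S2 == [set i in S | ~~ is_max S i])].

(* h_S as a monomial; the junk value 1 when #|S| < 2 is never used. *)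
Definition hmon S : hmonomial E :=
  if insub S is Some u then U_(enum_rank (u : hidx E))%MM else 0%MM.

(* h_S * h_T is normal when one of its two orderings satisfies (i)-(iii). *)
Definition normal m : bool :=
  [forall S : hidx E, forall T : hidx E,
     (hmon (val S) + hmon (val T) <= m)%MM ==>
       normal_pair (val S) (val T) || normal_pair (val T) (val S)].

(* Evaluation of polynomials in the h_S at h_S := g_S.  A monomial of NM_ss(E) is
   represented by the corresponding m in NM(E), so that the bijection f
   is the identity; its class in the Chow ring is g_eval 'X_[m]. *)
Definition g_eval (p : hpoly E) : chow E :=
  mmap (@chow_class E \o @mpolyC #|{: xidx E}| rat)
       (fun i => chow_g (val (enum_val i : hidx E))) p.

Definition is_rewriting (a : chow E) (r : hpoly E) : Prop :=
  all normal (msupp r) /\ g_eval r = a.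

Definition rewriting (a : chow E) : hpoly E :=
  epsilon (inhabits 0) (is_rewriting a).

End NormalMonomials.

(* An injection between the equipotent sets 'I_#|E| and E is a bijection.
   Positions are numbered from 0. *)
Notation arrangement E := {s : {ffun 'I_#|E| -> E} | injectiveb s}.

Section Codes.
Context {d : Order.disp_t} {E : finOrderType d}.
Implicit Types s : arrangement E.

Definition descents s : {set 'I_#|E|} :=
  [set i : 'I_#|E| |
     [exists j : 'I_#|E|, (j == i.+1 :> nat) && (val s j < val s i)%O]].

Definition desc_set s (i : 'I_#|E|) : {set E} :=
  [set val s j | j : 'I_#|E| & (i <= j)%N && (val s j <= val s i)%O].

Definition Psi s : hmonomial E :=
  (\sum_(i in descents s) hmon (desc_set s i))%MM.

Definition lehmer s : seq nat :=
  [seq #|[set j : 'I_#|E| | (j < i)%N && (val s i < val s j)%O]|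
  | i : 'I_#|E|].

End Codes.

(* An inversion sequence (e_1, ..., e_n) is stored as a list; entry e i is e_i. *)
Definition entry (e : seq nat) (i : nat) : nat := nth 0%N e i.-1.
Definition tabulate (n : nat) (u : nat -> nat) : seq nat :=
  [seq u i | i <- iota 1 n].

Definition is_invseq (n : nat) (e : seq nat) : Prop :=
  size e = n /\ forall i, (1 <= i <= n)%N -> (entry e i <= i - 1)%N.

(* The map g_n, computed on E; None is the symbol 0.  The inverses of lehmer and
   Psi are obtained by searching a preimage. *)
Definition g_map {d : Order.disp_t} (E : finOrderType d) (e : seq nat)
    : option (seq nat) :=
  if [pick s : arrangement E | lehmer s == e] is Some s then
    let r := rewriting (chow_g [set: E] * g_eval 'X_[Psi s]) in
    if r == 0 then None else
    omap lehmer [pick t : arrangement E | r == 'X_[Psi t]]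
  else None.

(* Main.v *)
(* Write a permutation as a word s1 ++ a :: s2 with a = max E, and let B be the set of letters
   of a :: s2.  If s2 is empty, g_E Psi(s) is the normal monomial of a :: s1.  If s1 is empty,
   Psi(s) = g_E Psi(s2) and g_E^2 = g_E g_(E - a), because x_E x_(E - a) = 0, so one recurses
   on E - a.  Otherwise Psi(s) is x_B Psi(s2) times the image of Psi(s1) in the star of x_B,
   and one recurses on E - B.  On Lehmer codes, where a sits at the last zero, this is the
   recursion of the theorem.

   Uniqueness of the rewriting is linear independence of the n! normal monomials.  Deform the
   linear relations to sum_(F containing i) x_F = t c_i with distinct nonzero c_i: the deformed
   ring has n! points, one for each maximal flag.  The normal monomials still span it over
   Q[t], so their matrix of values at the points is square with nonzero determinant.  A
   relation among them in the Chow ring becomes, after deformation, t times a combination of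
   normal monomials, so its coefficients vanish at t = 0. *)

Require Import Defs.
From HB Require Import structures.
From mathcomp Require Import all_boot all_order all_algebra.
From mathcomp Require Import mpoly boolp ring.
From Stdlib Require Import ClassicalEpsilon.

Set Implicit Arguments.
Unset Strict Implicit.
Unset Printing Implicit Defensive.

Import Order.TTheory GRing.Theory Num.Theory.
(** * Normal families *)

(** The recursions leave the Chow ring: CH(E - a) sits inside it by pullback, while CH(E - B) is
    only a factor of its quotient by the annihilator of x_B. Rather than building these rings and
    the maps between them, the proof stays in one commutative ring R and varies a ground set A, a
    family y in the role of the x_F, and a multiplier z; an equality [z * p = z * q] stands for
    equality modulo the annihilator of z. The linear forms are allowed arbitrary values c. With c =
    0 this framework gives the product with g_E, and with nonzero c the spanning theorem for the
    deformed ring; even there, restricting to a subset B changes c. The deformation is forced: in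
    the Chow ring every x_F is nilpotent, so its only point is the origin and values at points
    separate nothing. A rewriting of g_E m is exhibited directly by the recursion; spanning serves
    only independence, which also yields the injectivity of Psi. *)

Section NormalFamilies.
Context {d : Order.disp_t} {E : finOrderType d}.
Implicit Types (A B F G S T : {set E}) (M : {set {set E}}) (a m : E).

(* Here m = max S, and minimality in (ii) says that m is not in T. *)
Definition npair S T : bool :=
  [exists m in S :\: T, [&& [forall u in S, (u <= m)%O],
     [forall v in T, (v <= m)%O ==> (v \in S)] &
     (T \subset S) || [exists w in S :\: T, w != m]]].

Lemma npairP S T : reflect
  (exists m, [/\ m \in S, m \notin T, {in S, forall u, (u <= m)%O},
     {in T, forall v, (v <= m)%O -> v \in S} &
     T \subset S \/ exists w, [/\ w \in S, w \notin T & w != m]]) (npair S T).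
Proof.
apply: (iffP exists_inP) => [[m]|[m [mS mT Sm Tm H]]].
  rewrite inE => /andP[mT mS] /and3P[/forall_inP Sm /forall_inP Tm H].
  exists m; split => // [v vT vm|]; first exact: (implyP (Tm v vT)).
  case/orP: H => [->|/exists_inP[w]]; first by left.
  by rewrite inE => /andP[wT wS] wm; right; exists w.
exists m; first by rewrite inE mT.
apply/and3P; split; first exact/forall_inP.
  by apply/forall_inP => v vT; apply/implyP => /(Tm v vT).
case: H => [->//|[w [wS wT wm]]]; apply/orP; right.
by apply/exists_inP; exists w => //; rewrite inE wT.
Qed.

(** A normal monomial is encoded by the set of its indices. Nothing is lost: a square is never
    normal, since [npair S S] asks for an element of S outside S. *)
Definition normal_family A M : bool :=
  [forall S in M, (S \subset A) && (2 <= #|S|)%N] &&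
  [forall S in M, forall T in M, (S != T) ==> npair S T || npair T S].

Lemma normal_familyP A M : reflect
  ({in M, forall S, S \subset A /\ (2 <= #|S|)%N} /\
   {in M &, forall S T, S != T -> npair S T || npair T S}) (normal_family A M).
Proof.
apply: (iffP andP) => [[/forall_inP H1 /forall_inP H2]|[H1 H2]]; split.
- by move=> S /H1/andP.
- by move=> S T SM TM ST; move/forall_inP: (H2 S SM) => /(_ T TM)/implyP/(_ ST).
- by apply/forall_inP => S /H1[-> ->].
- apply/forall_inP => S SM; apply/forall_inP => T TM; apply/implyP.
  exact: H2.
Qed.

Lemma normal_family_sub A M M' :
  M' \subset M -> normal_family A M -> normal_family A M'.
Proof.
move=> /subsetP sM /normal_familyP[H1 H2]; apply/normal_familyP; split.
  by move=> S /sM; apply: H1.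
by move=> S T /sM SM /sM; apply: H2.
Qed.

Lemma normal_familyS A A' M :
  A \subset A' -> normal_family A M -> normal_family A' M.
Proof.
move=> sA /normal_familyP[H1 H2]; apply/normal_familyP; split => // S /H1[SA].
by split=> //; apply: subset_trans sA.
Qed.

Lemma normal_family_restrict A A' M :
  {in M, forall S, S \subset A'} -> normal_family A M -> normal_family A' M.
Proof.
move=> sA /normal_familyP[H1 H2]; apply/normal_familyP; split => // S SM.
by split; [apply: sA | case: (H1 S SM)].
Qed.

Lemma normal_family_set0 A : normal_family A set0.
Proof. by apply/normal_familyP; split => [S|S T]; rewrite inE. Qed.

(* If a word is s1 ++ a :: s2 with a its largest letter and B the set of letters of a :: s2,
   then fill B maps each S(s1, i) to S(s1 ++ a :: s2, i). *)
Definition fill B F : {set E} := F :|: [set b in B | [exists u in F, (b <= u)%O]].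

Lemma fillE B F v :
  (v \in fill B F) = (v \in F) || (v \in B) && [exists u in F, (v <= u)%O].
Proof. by rewrite !inE. Qed.

Lemma fillD B F : [disjoint F & B] -> fill B F :\: B = F.
Proof.
move=> dFB; apply/setP => v; rewrite inE fillE.
case vB: (v \in B) => /=; last by rewrite orbF.
by apply/esym/negbTE/negP => vF; rewrite (disjointFr dFB vF) in vB.
Qed.

Lemma fill_max B F m : {in F, forall u, (u <= m)%O} ->
  {in fill B F, forall u, (u <= m)%O}.
Proof.
move=> Fm u; rewrite fillE => /orP[/Fm//|/andP[_ /exists_inP[v vF uv]]].
exact: le_trans uv (Fm v vF).
Qed.

Lemma sub_fill B F : F \subset fill B F.
Proof. exact: subsetUl. Qed.

Lemma fill_subset A B F : F \subset A -> B \subset A -> fill B F \subset A.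
Proof.
move=> FA BA; rewrite subUset FA; apply/subsetP => v; rewrite inE => /andP[vB _].
exact: (subsetP BA).
Qed.

(** The elements added by [fill] lie below F, so the maximum does not move; the added parts are
    initial segments of B, cut at max F and max G. *)
Lemma npair_fill B F G : [disjoint F & B] -> [disjoint G & B] ->
  npair (fill B F) (fill B G) = npair F G.
Proof.
move=> dF dG; apply/npairP/npairP => -[m [mS mT Sm Tm H]].
  have mF : m \in F.
    move: mS; rewrite fillE => /orP[//|/andP[_ /exists_inP[u uF mu]]].
    suff -> : m = u by [].
    by apply: le_anti; rewrite mu Sm // (subsetP (sub_fill B F)).
  have GF v : v \in G -> (v <= m)%O -> v \in F.
    move=> vG /Tm; rewrite !fillE vG => /(_ isT) /orP[//|/andP[vB]].
    by rewrite (disjointFr dG vG) in vB.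
  exists m; split=> //.
  - by move: mT; rewrite fillE negb_or => /andP[].
  - by move=> u uF; apply: Sm; rewrite fillE uF.
  case: H => [GF'|[w [wS wT wm]]].
    left; rewrite -(fillD dF) -(fillD dG).
    exact: setSD.
  move: wS wT; rewrite !fillE => /orP[wF|/andP[wB /exists_inP[u uF wu]]].
    by rewrite negb_or => /andP[wG _]; right; exists w.
  (* A witness w in B outside [fill B G] lies above all of G, yet below some u in F: so G lies below
     m, and the inclusion alternative holds instead. *)
  rewrite wB /= negb_or => /andP[_ /exists_inP Hw]; left.
  apply/subsetP => v vG; apply: GF => //.
  case: (leP v w) => [vw|/ltW wv]; last by case: Hw; exists v.
  by apply: le_trans vw (le_trans wu _); apply: Sm; rewrite fillE uF.
have mB : m \in B = false by rewrite (disjointFr dF mS).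
exists m; split.
- by rewrite fillE mS.
- by rewrite fillE (negbTE mT) mB.
- exact: fill_max.
- move=> v; rewrite !fillE => /orP[vG vm|/andP[vB _] vm]; first by rewrite Tm.
  by rewrite vB /=; apply/orP; right; apply/exists_inP; exists m.
case: H => [GF|[w [wF wG wm]]].
  left; apply: setUSS => //; apply/subsetP => v; rewrite !inE.
  case/andP=> -> /exists_inP[u uG vu]; apply/exists_inP; exists u => //.
  exact: (subsetP GF).
by right; exists w; rewrite !fillE wF (negbTE wG) (disjointFr dF wF).
Qed.

Lemma set_max A : A != set0 -> exists2 m, m \in A & {in A, forall u, (u <= m)%O}.
Proof.
case/set0Pn => i0 i0A; exists [arg max_(i > i0 in A) i]%O.
  by case: arg_maxP.
by case: arg_maxP => // i _ H j; apply: H.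
Qed.

(* The normal families of A in which B is the member containing a = max A: M1 ranges over
   the normal families of A :\: B and M2 over those of B :\ a. *)
Definition join B M1 M2 : {set {set E}} := B |: (M2 :|: fill B @: M1).

Section Join.
Variables (A B : {set E}) (a : E).
Hypotheses (BA : B \subset A) (aB : a \in B) (amax : {in A, forall u, (u <= a)%O}).

(** Each [fill B F] precedes every subset of B, through max F and a second element of F, both
    outside B; and B precedes each member of M2, through a. Inside M1 the order is preserved by
    [npair_fill]. *)
Lemma join_normal M1 M2 : (2 <= #|B|)%N -> normal_family (A :\: B) M1 ->
  normal_family (B :\ a) M2 -> normal_family A (join B M1 M2).
Proof.
move=> B2 /normal_familyP[M1A M1n] /normal_familyP[M2B M2n].
have d1 F : F \in M1 -> [disjoint F & B].
  by case/M1A => /subsetDP[].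
have B_M2 S : S \in M2 -> npair B S.
  case/M2B => /subsetD1P[SB aS] _; apply/npairP; exists a.
  by split=> // [u|v|]; [move/(subsetP BA); apply: amax |move/(subsetP SB) |left].
have M1_sub F S : F \in M1 -> S \subset B -> npair (fill B F) S.
  move=> FM1 SB; have [FA F2] := M1A F FM1.
  have [|m mF Fm] := @set_max F; first by rewrite -card_gt0; apply: leq_trans F2.
  have dF := d1 F FM1; have dS u : u \in F -> u \notin S.
    by move=> uF; apply/negP => /(subsetP SB); rewrite (disjointFr dF uF).
  apply/npairP; exists m; split; last 1 first.
  - right; have [|w] := @set0Pn _ (F :\ m) _.
      by rewrite -card_gt0; move: F2; rewrite (cardsD1 m) mF.
    by rewrite !inE => /andP[wm wF]; exists w; rewrite fillE wF dS.
  - by rewrite fillE mF.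
  - exact: dS.
  - exact: fill_max.
  - move=> v /(subsetP SB) vB vm; rewrite fillE vB /=; apply/orP; right.
    by apply/exists_inP; exists m.
apply/normal_familyP; split.
  move=> S /setU1P[->//|/setUP[/M2B[SB ->]|/imsetP[F /M1A[FA F2] ->]]].
    by split=> //; apply: subset_trans SB (subset_trans (subsetDl _ _) BA).
  split; first by apply: fill_subset => //; apply: subset_trans FA (subsetDl _ _).
  exact: leq_trans F2 (subset_leq_card (sub_fill _ _)).
move=> S T /setU1P HS /setU1P HT ST.
have sub2 U : U \in M2 -> U \subset B.
  by case/M2B => UB _; apply: subset_trans UB (subsetDl _ _).
case: HS => [eS|/setUP[SM|/imsetP[F FM eS]]];
case: HT => [eT|/setUP[TM|/imsetP[G GM eT]]]; rewrite ?eS ?eT.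
- by rewrite eS eT eqxx in ST.
- by rewrite B_M2.
- by rewrite [X in _ || X]M1_sub ?orbT.
- by rewrite [X in _ || X]B_M2 ?orbT.
- exact: M2n.
- by rewrite [X in _ || X]M1_sub ?orbT ?sub2.
- by rewrite M1_sub.
- by rewrite M1_sub ?sub2.
rewrite !npair_fill ?d1 //; apply: M1n => //.
by apply: contraNneq ST => FG; rewrite eS eT FG.
Qed.

(** A member S other than B is recovered as [fill B (S :\: B)] if it precedes B, and lies in
    [B :\ a] if it follows B. *)
Lemma normal_family_split M : normal_family A M -> B \in M ->
  exists M1 M2, [/\ normal_family (A :\: B) M1, normal_family (B :\ a) M2 &
                    M = join B M1 M2].
Proof.
move=> /normal_familyP[MA Mn] BM.
have M1P S : S \in M -> npair S B ->
    S = fill B (S :\: B) /\ (2 <= #|S :\: B|)%N.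
  move=> SM /npairP[m [mS mB Sm Bm H]]; split.
    apply/setP => v; rewrite fillE !inE; case vB: (v \in B) => //=; last by rewrite orbF.
    apply/idP/exists_inP => [vS|[u]].
      by exists m; [rewrite inE mB | apply: Sm].
    by rewrite inE => /andP[_ uS] vu; apply: Bm => //; apply: le_trans vu (Sm u uS).
  (* B is not contained in S: otherwise the maximum m of S would be a, which lies in B. *)
  case: H => [/subsetP/(_ a aB)/Sm am|[w [wS wB wm]]].
    suff ma : m = a by rewrite ma aB in mB.
    apply: le_anti; rewrite am amax //.
    by case: (MA S SM) => /subsetP SA _; apply: SA.
  rewrite (cardsD1 m) (cardsD1 w) !inE mB mS wB wS wm //.
have M2P S : S \in M -> npair B S -> S \subset B :\ a.
  move=> SM /npairP[m [mB mS Bm Sm _]].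
  have ma : m = a by apply: le_anti; rewrite Bm // amax // (subsetP BA).
  subst m; have [SA _] := MA S SM; apply/subsetP => v vS; rewrite !inE.
  by rewrite (memPn mS) // Sm // amax // (subsetP SA).
pose M2 := [set S in M | S \subset B :\ a].
pose N1 := [set S in M | npair S B].
have N1P S : S \in N1 -> S = fill B (S :\: B) /\ (2 <= #|S :\: B|)%N.
  by rewrite inE => /andP[]; apply: M1P.
exists [set S :\: B | S in N1], M2; split.
- apply/normal_familyP; split.
    move=> _ /imsetP[S SN ->]; split; last by case: (N1P S SN).
    by apply: setSD; move: SN; rewrite inE => /andP[/MA[]].
  move=> _ _ /imsetP[S SN ->] /imsetP[T TN ->] ST.
  have dB U : [disjoint U :\: B & B] by rewrite -setI_eq0; apply/eqP/setP => v; rewrite !inE andbAC andNb.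
  rewrite -[npair _ _](npair_fill (dB S) (dB T)) -[npair (T :\: B) _](npair_fill (dB T) (dB S)).
  case: (N1P S SN) (N1P T TN) => <- _ [<- _]; apply: Mn.
  + by move: SN; rewrite inE => /andP[].
  + by move: TN; rewrite inE => /andP[].
  by apply: contraNneq ST => ->.
- apply: (@normal_family_restrict A).
    by move=> S; rewrite inE => /andP[].
  apply: (normal_family_sub _ (_ : normal_family A M)); last exact/normal_familyP.
  by apply/subsetP => S; rewrite inE => /andP[].
rewrite /join; have -> : fill B @: [set S :\: B | S in N1] = N1.
  apply/setP => T; apply/imsetP/idP => [[_ /imsetP[S SN ->] ->]|TN].
    by case: (N1P S SN) => <-.
  by exists (T :\: B); [apply: imset_f | case: (N1P T TN)].
apply/setP => S; rewrite !inE; have [->|SB] /= := eqVneq S B; first by [].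
apply/idP/orP => [SM|[/andP[]|/andP[]] //].
by case/orP: (Mn S B SM BM SB) => H; [right|left]; rewrite SM //= M2P.
Qed.
End Join.
End NormalFamilies.

(** * Words, their descent families and their codes *)

Section Words.
Context {d : Order.disp_t} {E : finOrderType d}.
Implicit Types (s p q : seq E) (A B S : {set E}) (M : {set {set E}}).

(* The support of Psi. *)
Fixpoint word_family s : {set {set E}} :=
  if s is x :: s' then
    if s' is y :: _ then
      if (y < x)%O then [set v in s | (v <= x)%O] |: word_family s'
      else word_family s'
    else set0
  else set0.

Lemma word_family_cons x y s : word_family (x :: y :: s) =
  if (y < x)%O then [set v in x :: y :: s | (v <= x)%O] |: word_family (y :: s)
  else word_family (y :: s).
Proof. by []. Qed.

(* p lists the letters already read. *)
Fixpoint code_aux p s : seq nat :=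
  if s is x :: s' then count (fun y => x < y)%O p :: code_aux (x :: p) s'
  else [::].

Definition code s := code_aux [::] s.

Lemma code_aux_cat p s1 s2 :
  code_aux p (s1 ++ s2) = code_aux p s1 ++ code_aux (rev s1 ++ p) s2.
Proof.
by elim: s1 p => //= x s1 IH p; rewrite IH rev_cons cat_rcons.
Qed.

Lemma eq_code_aux p q s : perm_eq p q -> code_aux p s = code_aux q s.
Proof.
elim: s p q => //= x s IH p q pq; rewrite (permP pq); congr (_ :: _).
by apply: IH; rewrite perm_cons.
Qed.

Lemma code_aux_max p a s : {in s, forall x, (x < a)%O} ->
  code_aux (a :: p) s = map S (code_aux p s).
Proof.
elim: s p => //= x s IH p H; rewrite H ?mem_head //; congr (_ :: _).
rewrite -IH => [|y ys]; last by apply: H; rewrite inE ys orbT.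
by apply: eq_code_aux; apply/permP => r /=; rewrite addnCA.
Qed.

Lemma size_code_aux p s : size (code_aux p s) = size s.
Proof. by elim: s p => //= x s IH p; rewrite IH. Qed.

Lemma code_split s1 a s2 : {in s1, forall x, (x < a)%O} ->
  code (s1 ++ a :: s2) = code s1 ++ 0%N :: code_aux (a :: s1) s2.
Proof.
move=> H; rewrite /code code_aux_cat /=; congr (_ ++ _ :: _).
  rewrite cats0 count_rev; apply/eqP; rewrite -leqn0 leqNgt -has_count.
  by apply/hasPn => x /H; rewrite -leNgt => /ltW.
by apply: eq_code_aux; rewrite cats0 perm_cons perm_rev.
Qed.

Lemma code_max_head a s : {in s, forall x, (x < a)%O} ->
  code (a :: s) = 0%N :: map S (code s).
Proof. by move=> H; rewrite -(code_aux_max _ H). Qed.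

(** A nonzero entry means that a larger letter has been read, so the bound a passes from the letters
    read to the next one. *)
Lemma code_aux_pos p s a : {in p, forall x, (x <= a)%O} ->
  all (fun k => k != 0%N) (code_aux p s) -> {in s, forall x, (x < a)%O}.
Proof.
elim: s p => //= x s IH p pa /andP[]; rewrite -lt0n -has_count => /hasP[y yp xy].
have xa := lt_le_trans xy (pa y yp).
move/IH => H z; rewrite inE => /predU1P[->//|]; apply: H => t.
by rewrite inE => /predU1P[->|/pa//]; apply: ltW.
Qed.

(* The last zero of a code marks the position of the largest letter. *)
Lemma code_split_inv s e1 e2 : uniq s -> code s = e1 ++ 0%N :: e2 ->
  all (fun k => k != 0%N) e2 ->
  exists s1 a s2, [/\ s = s1 ++ a :: s2, size s1 = size e1, size s2 = size e2 &
    code s1 = e1 /\ {in s1 ++ s2, forall x, (x < a)%O}].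
Proof.
move=> us es e2p.
have sz : size s = (size e1 + (size e2).+1)%N.
  by rewrite -(size_code_aux [::] s) -/(code s) es size_cat.
have lt : (size e1 < size s)%N by rewrite sz addnS ltnS leq_addr.
case: s us es sz lt => [|x0 s0] //; set s := x0 :: s0 => us es sz lt.
set s1 := take (size e1) s; set a := nth x0 s (size e1).
set s2 := drop (size e1).+1 s.
have es12 : s = s1 ++ a :: s2 by rewrite -drop_nth // cat_take_drop.
have sz1 : size s1 = size e1 by rewrite size_takel // ltnW.
have sz2 : size s2 = size e2 by rewrite size_drop sz addnS subSS addKn.
move: es; rewrite es12 /code code_aux_cat => /eqP.
rewrite eqseq_cat ?size_code_aux // => /andP[/eqP e1E /= /eqP[cz e2E]].
have s1a : {in s1, forall x, (x < a)%O}.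
  move=> x xs1; rewrite lt_neqAle; apply/andP; split.
    move: us; rewrite es12 cat_uniq /= negb_or => /and3P[_ /andP[aNs1 _] _].
    by apply: contraNneq aNs1 => <-.
  have := cz; rewrite cats0 count_rev => /eqP; rewrite -leqn0 leqNgt -has_count.
  by move/hasPn/(_ x xs1); rewrite -leNgt.
exists s1, a, s2; split=> //; split=> // x; rewrite mem_cat => /orP[/s1a//|].
apply: (@code_aux_pos (a :: rev s1 ++ [::])); last by rewrite e2E.
move=> y; rewrite inE cats0 mem_rev => /predU1P[->//|/s1a]; exact: ltW.
Qed.

Lemma word_split s : s != [::] -> uniq s -> exists s1 a s2,
  s = s1 ++ a :: s2 /\ {in s1 ++ s2, forall x, (x < a)%O}.
Proof.
case: s => // x0 s0 _; set s := x0 :: s0 => us.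
have [|a] := @set_max _ _ [set v in s].
  by apply/set0Pn; exists x0; rewrite inE mem_head.
rewrite inE => as_; case/splitPr: as_ us => s1 s2 us amax.
exists s1, a, s2; split=> // x xs; rewrite lt_neqAle; apply/andP; split.
  move: us; rewrite -cat1s uniq_catCA /= => /andP[aN _].
  by apply: contraNneq aN => <-.
by apply: amax; rewrite inE; move: xs; rewrite !mem_cat inE => /orP[]->; rewrite ?orbT.
Qed.

(** Induction along the decreasing binary tree of a word, whose root is its largest letter. *)
Lemma word_ind (P : seq E -> Prop) : P [::] ->
  (forall s1 a s2, uniq (s1 ++ a :: s2) -> {in s1 ++ s2, forall x, (x < a)%O} ->
     P s1 -> P s2 -> P (s1 ++ a :: s2)) ->
  forall s, uniq s -> P s.
Proof.
move=> P0 PS s; have [n] := ubnP (size s); elim: n s => // n IH s.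
have [->//|sN /ltnSE sn us] := eqVneq s [::].
have [s1 [a [s2 [es sa]]]] := word_split sN us; subst s.
move: sn us; rewrite size_cat /= addnS => sn us.
have := us; rewrite cat_uniq /= => /and3P[u1 _ /andP[_ u2]].
apply: PS => //; apply: IH => //; apply: leq_trans sn; rewrite ltnS.
  exact: leq_addr.
exact: leq_addl.
Qed.

(** A final maximum creates no descent and exceeds every descent top, so it enters none of the
    sets. *)
Lemma word_family_rcons s a : {in s, forall x, (x < a)%O} ->
  word_family (rcons s a) = word_family s.
Proof.
elim: s => // x [|y s] IH H; first by rewrite /= ltNge ltW // H // mem_head.
rewrite !rcons_cons !word_family_cons -rcons_cons IH => [|z zs]; last first.
  by apply: H; rewrite inE zs orbT.
case: ifP => // yx; congr (_ |: _); apply/setP => v; rewrite !inE mem_rcons inE.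
case: (v =P a) => [->|_ //]; by rewrite leNgt H ?mem_head // !andbF.
Qed.

(** As s2 is nonempty, a is a descent top and contributes the set B of all letters from a on.
    Descents inside s2 do not see what precedes them, and a descent of s1 with top x gains the
    letters of B below x. *)
Lemma word_family_join s1 a s2 : {in s1 ++ s2, forall x, (x < a)%O} ->
  s2 != [::] ->
  word_family (s1 ++ a :: s2) =
    join [set v in a :: s2] (word_family s1) (word_family s2).
Proof.
move=> H s2N; have Ha : {in s2, forall x, (x < a)%O}.
  by move=> x xs; apply: H; rewrite mem_cat xs orbT.
have base : word_family (a :: s2) =
            [set v in a :: s2] |: word_family s2.
  case: s2 s2N {H} Ha => // y s2 _ Ha; rewrite word_family_cons Ha ?mem_head //.
  congr (_ |: _); apply/setP => v; rewrite !inE.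
  case: eqVneq => [->|_] /=; first by rewrite lexx.
  by apply/andb_idr; rewrite -in_cons => /Ha/ltW.
elim: s1 H => [|x s1 IH] H; first by rewrite /join /= imset0 setU0 -base.
have {}IH := IH (fun z zs => H z (mem_behead (s := x :: s1 ++ s2) zs)).
have eB v : v \in [set v in a :: s2] = (v \in a :: s2) by rewrite inE.
case: s1 => [|y s1] in H IH *.
  (* The last letter of s1 is followed by the larger letter a: no descent there. *)
  by rewrite [LHS]word_family_cons ltNge ltW ?H ?mem_head.
rewrite !cat_cons !word_family_cons -cat_cons IH; case: ifP => // yx.
rewrite {IH} /join imsetU1 [X in _ = _ |: X]setUCA [RHS]setUCA; congr (_ |: _).
apply/setP => v; rewrite fillE !inE mem_cat !inE !andb_orl -!orbA.
(* The top x is the maximum of its own descent set, so the condition in [fill] reduces to comparison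
   with x. *)
have -> : [exists u in [set u in [:: x, y & s1] | (u <= x)%O], (v <= u)%O] = (v <= x)%O.
  apply/exists_inP/idP => [[u]|vx]; last by exists x; rewrite // !inE eqxx lexx.
  by rewrite inE => /andP[_ ux] /le_trans/(_ ux).
by [].
Qed.

Lemma uniq_setD s1 a s2 : uniq (s1 ++ a :: s2) ->
  [set v in s1 ++ a :: s2] :\: [set v in a :: s2] = [set v in s1].
Proof.
rewrite cat_uniq => /and3P[_ /hasPn H _]; apply/setP => v.
rewrite !inE mem_cat -in_cons; case vs: (v \in a :: s2) => /=.
  by rewrite (negbTE (H v vs)).
by rewrite orbF.
Qed.

Lemma uniq_setD1 a s : uniq (a :: s) -> [set v in a :: s] :\ a = [set v in s].
Proof.
move=> /= /andP[aN _]; apply/setP => v; rewrite !inE.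
by case: eqVneq => //= ->; rewrite (negbTE aN).
Qed.

Lemma word_family_normal s : uniq s -> normal_family [set v in s] (word_family s).
Proof.
move: s; apply: word_ind => [|s1 a s2 us sa IH1 IH2].
  exact: normal_family_set0.
have [s20|s2N] := eqVneq s2 [::].
  rewrite s20 cats0 in sa; rewrite s20 cats1 word_family_rcons //.
  apply: normal_familyS IH1; apply/subsetP => v; rewrite !inE mem_rcons => vs.
  by rewrite inE vs orbT.
have us2 : uniq (a :: s2) by move: us; rewrite cat_uniq => /and3P[].
rewrite word_family_join //; apply: (@join_normal _ _ _ _ a).
- by apply/subsetP => v; rewrite !inE mem_cat inE => ->; rewrite orbT.
- by rewrite inE mem_head.
- move=> v; rewrite inE mem_cat inE orbCA -mem_cat => /predU1P[->//|/sa]; exact: ltW.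
- by rewrite cardsE (card_uniqP us2) /=; case: s2 s2N {us sa IH2 us2}.
- by rewrite uniq_setD.
- by rewrite uniq_setD1.
Qed.

(** Inverse of Psi: a member containing a = max A lists a and the letters after it; when there is
    none, a is the last letter. *)
Lemma word_family_surj A M : normal_family A M ->
  exists s, [/\ uniq s, [set v in s] = A & word_family s = M].
Proof.
have [n] := ubnP #|A|; elim: n A M => // n IH A M /ltnSE An AM.
have [A0|AN] := eqVneq A set0.
  subst A; exists [::]; split; [by [] | by apply/setP => v; rewrite !inE |].
  apply/esym/eqP; rewrite -subset0; apply/subsetP => S SM.
  have [/(_ S SM)[SA S2] _] := normal_familyP _ _ AM.
  by move: SA S2; rewrite subset0 => /eqP->; rewrite cards0.
have [a aA amax] := set_max AN.
have ltA A' : A' \subset A :\ a -> (#|A'| < n)%N.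
  move=> /subset_leq_card; rewrite -ltnS => /leq_trans; apply.
  by move: An; rewrite (cardsD1 a) aA.
case: (pickP [pred B in M | a \in B]) => [B /= /andP[BM aB]|noB].
  have [/(_ B BM)[BA B2] _] := normal_familyP _ _ AM.
  have [M1 [M2 [n1 n2 eM]]] := normal_family_split BA aB amax AM BM.
  have [|s1 [u1 e1 f1]] := IH _ _ _ n1.
    by apply: ltA; apply/subsetP => v; rewrite !inE => /andP[vB ->]; rewrite andbT; apply: contraNneq vB => ->.
  have [|s2 [u2 e2 f2]] := IH _ _ _ n2; first by apply: ltA; apply: setSD.
  have m1 v : (v \in s1) = (v \notin B) && (v \in A) by move/setP/(_ v): e1; rewrite !inE.
  have m2 v : (v \in s2) = (v != a) && (v \in B) by move/setP/(_ v): e2; rewrite !inE.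
  have eB : [set v in a :: s2] = B.
    by apply/setP => v; rewrite !inE m2; case: eqVneq => //= ->.
  exists (s1 ++ a :: s2); split.
  - rewrite cat_uniq u1 /= m2 eqxx u2 andbT /= m1 aB /=.
    by rewrite andbT; apply/hasPn => v; rewrite m2 /= m1 => /andP[_ ->].
  - apply/setP => v; rewrite inE mem_cat -[v \in a :: s2]in_set eB m1.
    by case vB: (v \in B) => /=; rewrite ?orbF // (subsetP BA).
  rewrite word_family_join ?eB ?f1 ?f2 //.
    move=> x; rewrite mem_cat m1 m2 => xs; rewrite lt_neqAle amax ?andbT.
      by case/orP: xs => /andP[xB _] //; apply: contraNneq xB => ->.
    by case/orP: xs => /andP[_] //; apply: (subsetP BA).
  apply: contraTneq B2 => s20; rewrite -eB s20 -leqNgt.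
  by rewrite (_ : [set v in [:: a]] = [set a]) ?cards1 //; apply/setP => v; rewrite !inE.
have [|s [us es fs]] := IH (A :\ a) M (ltA _ (subxx _)).
  apply: normal_family_restrict (AM) => S SM.
  have [/(_ S SM)[SA S2] _] := normal_familyP _ _ AM.
  by rewrite subsetD1 SA /=; have := noB S; rewrite /= SM /= => ->.
have ms v : (v \in s) = (v != a) && (v \in A) by move/setP/(_ v): es; rewrite !inE.
exists (rcons s a); split.
- by rewrite rcons_uniq us ms eqxx.
- by apply/setP => v; rewrite inE mem_rcons inE ms; case: eqVneq => // ->.
rewrite word_family_rcons // => x; rewrite ms => /andP[xa xA].
by rewrite lt_neqAle xa amax.
Qed.

End Words.

(** * Chow relations relative to a subset and a multiplier *)

Section RelativeChow.
Local Open Scope ring_scope.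
Context {d : Order.disp_t} {E : finOrderType d} {R : comPzRingType}.
Implicit Types (A B F G S : {set E}) (M : {set {set E}}) (a i : E).
Implicit Types (z w x p q : R) (y g s : {set E} -> R) (c : E -> R) (k : R -> Prop).

(* The x_F on the ground set A, with relations only required to hold after multiplication by
   z, and deformed by giving the i-th linear form the value c i instead of 0. *)
Definition chow_datum A z y c : Prop :=
  (forall F G, F \subset A -> G \subset A -> incomparable F G ->
     z * (y F * y G) = 0) /\
  (forall i, i \in A -> z * (\sum_(F : {set E} | (F \subset A) && (i \in F)) y F) = z * c i).

(** G is F with elements of A larger than max F adjoined, so that [gsum A y] is the family of the
    g_F on the ground set A. *)
Definition upper A F G : bool :=
  [&& F \subset G, G \subset A & [forall v in G :\: F, forall u in F, (u < v)%O]].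

Definition gsum A y F : R := \sum_(G | upper A F G) y G.

Lemma upperP A F G : reflect
  [/\ F \subset G, G \subset A & forall v u, v \in G -> v \notin F -> u \in F -> (u < v)%O]
  (upper A F G).
Proof.
apply: (iffP and3P) => -[FG GA H]; split=> //.
  move=> v u vG vF uF; move/forall_inP: H => /(_ v); rewrite inE vF vG => /(_ isT).
  by move/forall_inP; apply.
apply/forall_inP => v; rewrite inE => /andP[vF vG]; apply/forall_inP => u.
exact: H.
Qed.

Lemma chow_datumM A z y c w : chow_datum A z y c -> chow_datum A (z * w) y c.
Proof.
move=> [H1 H2]; split=> [F G FA GA FG|i iA].
  by rewrite mulrAC H1 // mul0r.
by rewrite mulrAC H2 // mulrAC.
Qed.

(* pull realizes CH(A :\ a) -> CH(A), the pullback forgetting a; contract realizes the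
   factor CH(A :\: B) of CH(A) / ann(x_B). *)
Definition pull a y F : R := y F + y (a |: F).
Definition contract B y F : R := y (F :|: B).

Lemma incomparableP F G : incomparable F G <->
  (exists2 v, v \in F & v \notin G) /\ (exists2 v, v \in G & v \notin F).
Proof.
rewrite /incomparable; split=> [/andP[/subsetPn H1 /subsetPn H2]//|[H1 H2]].
by apply/andP; split; apply/subsetPn.
Qed.

Lemma sum_split_max a A (P : pred {set E}) y : a \in A ->
  \sum_(G : {set E} | (G \subset A) && P G) y G =
  \sum_(G : {set E} | (G \subset A :\ a) && P G) y G +
  \sum_(G : {set E} | (G \subset A :\ a) && P (a |: G)) y (a |: G).
Proof.
move=> aA; rewrite (bigID (fun G : {set E} => a \notin G)) /=; congr (_ + _).
  by apply: eq_bigl => G; rewrite subsetD1 andbAC.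
rewrite (reindex_onto (fun G => a |: G) (fun G => G :\ a)) /= => [|G]; last first.
  by case/andP => _; rewrite negbK; apply: setD1K.
apply: eq_bigl => G; rewrite subUset sub1set aA setU11 /= andbT subsetD1.
case aG: (a \in G) => /=; last by rewrite setU1K ?aG // eqxx !andbT.
rewrite !andbF; apply/negbTE; rewrite negb_and; apply/orP; right.
by apply: contraTneq aG => <-; rewrite setD11.
Qed.

Lemma chow_datum_pull A z y c a : a \in A -> chow_datum A z y c ->
  chow_datum (A :\ a) z (pull a y) c.
Proof.
move=> aA [H1 H2]; split=> [F G /subsetD1P[FA aF] /subsetD1P[GA aG] FG|i].
  have /incomparableP[[u uF uG] [v vG vF]] := FG.
  have ua : u != a by apply: contraNneq aF => <-.
  have va : v != a by apply: contraNneq aG => <-.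
  have UA F' : F' \subset A -> a |: F' \subset A by rewrite subUset sub1set aA.
  rewrite mulrDl !mulrDr !H1 ?UA ?addr0 //; apply/incomparableP; split;
    by [exists u => //; rewrite !inE ?uF ?(negbTE ua) ?orbT |
        exists v => //; rewrite !inE ?vG ?(negbTE va) ?orbT].
rewrite !inE => /andP[ia iA]; rewrite -H2 // (sum_split_max _ _ aA) /pull big_split.
by congr (_ * (_ + _)); apply: eq_bigl => G; rewrite !inE (negbTE ia).
Qed.

(** Since a exceeds all of F, adjoining it to G does not affect [upper]; the pairs G, [a |: G] are
    the two terms of [pull]. *)
Lemma gsum_pull A y a F : a \in A -> {in A, forall u, (u <= a)%O} ->
  F \subset A :\ a -> gsum (A :\ a) (pull a y) F = gsum A y F.
Proof.
move=> aA amax /subsetD1P[FA aF]; rewrite /gsum.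
under [RHS]eq_bigl => G do rewrite /upper andbCA.
rewrite (sum_split_max _ _ aA) /pull big_split; congr (_ + _).
  by apply: eq_bigl => G; rewrite /upper andbCA.
apply: eq_bigl => G; rewrite {1}/upper [LHS]andbCA; case GA: (G \subset A :\ a) => //=.
have /subsetD1P[_ aG] := GA.
have -> : F \subset a |: G = (F \subset G).
  by rewrite -(setU1K aG) subsetD1 aF andbT setU1K.
congr (_ && _); apply/forall_inP/forall_inP => H v.
  rewrite !inE => /andP[vF /predU1P[->|vG]].
    apply/forall_inP => u uF; rewrite lt_neqAle (memPn aF) //.
    by apply: amax; apply: (subsetP FA).
  by apply: H; rewrite inE vF.
by rewrite inE => /andP[vF vG]; apply: H; rewrite !inE vF vG orbT.
Qed.

Lemma sum_above A B z y (P : pred {set E}) : B \subset A ->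
  (forall G, P G -> G \subset A -> ~~ (B \subset G) -> z * y G = 0) ->
  z * (\sum_(G : {set E} | (G \subset A) && P G) y G) =
  z * (\sum_(F : {set E} | (F \subset A :\: B) && P (F :|: B)) contract B y F).
Proof.
move=> BA H; rewrite (bigID (fun G => B \subset G)) /= mulrDr.
rewrite [X in _ + X]mulr_sumr [X in _ + X]big1 ?addr0 => [|G /andP[/andP[GA PG]]]; last exact: H.
congr (_ * _); rewrite (reindex_onto (fun F => F :|: B) (fun G => G :\: B)) /=.
  apply: eq_bigl => F; rewrite subUset BA subsetUr !andbT subsetD.
  rewrite andbAC; congr (_ && _ && _).
  rewrite setDUl setDv setU0; apply/eqP/idP => [<-|]; last exact/setDidPl.
  by rewrite -setI_eq0; apply/eqP/setP => v; rewrite !inE andbAC andNb.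
by move=> G /andP[_ BG]; rewrite setUC -{1}(setIidPr BG) setID.
Qed.

(** A set containing some i outside B either contains B or is incomparable with B, and then [y B]
    kills it. *)
Lemma chow_datum_contract A B z y c : B \subset A -> B != set0 ->
  chow_datum A z y c -> chow_datum (A :\: B) (z * y B) (contract B y) c.
Proof.
move=> BA /set0Pn[b bB] [H1 H2]; split=> [F G FA GA FG|i].
  rewrite mulrAC H1 ?mul0r //; rewrite ?subUset ?BA ?andbT.
  - by apply: subset_trans FA (subsetDl _ _).
  - by apply: subset_trans GA (subsetDl _ _).
  have [/subsetDP[_ dF] /subsetDP[_ dG]] := (FA, GA).
  have /incomparableP[[u uF uG] [v vG vF]] := FG; apply/incomparableP; split.
    by exists u; rewrite !inE ?uF // (negbTE uG) (disjointFr dF uF).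
  by exists v; rewrite !inE ?vG // (negbTE vF) (disjointFr dG vG).
rewrite inE => /andP[iB iA].
have -> : z * y B * c i = y B * (z * c i) by ring.
rewrite -H2 // mulrA [y B * z]mulrC (sum_above BA).
  by congr (_ * _); apply: eq_bigl => F; rewrite !inE (negbTE iB) orbF.
move=> G iG GA nBG; rewrite -mulrA H1 //; apply/andP; split=> //.
by apply: contraNN iB => /subsetP; apply.
Qed.

(** Against [y B] only the sets containing B survive. They can be upper to [fill B F] because the
    elements of B missing from it exceed all of F. *)
Lemma gsum_contract A B z y c F : B \subset A -> F \subset A :\: B -> F != set0 ->
  chow_datum A z y c ->
  z * y B * gsum A y (fill B F) = z * y B * gsum (A :\: B) (contract B y) F.
Proof.
move=> BA FA /set0Pn[f fF] [H1 H2]; rewrite /gsum.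
have [FA' dF] := subsetDP FA.
under eq_bigl => G do rewrite /upper andbCA.
rewrite (sum_above BA).
  congr (_ * _); apply: eq_bigl => G; rewrite [RHS]/upper [RHS]andbCA.
  case GA: (G \subset A :\: B) => //=; have [GA' dG] := subsetDP GA.
  have -> : fill B F \subset G :|: B = (F \subset G).
    apply/idP/idP => [/(subset_trans (sub_fill B F)) FG|FG].
      apply/subsetP => v vF; have := subsetP FG v vF.
      by rewrite inE (disjointFr dF vF) orbF.
    apply/subsetP => v; rewrite fillE inE => /orP[/(subsetP FG)->//|/andP[-> _]].
    by rewrite orbT.
  case FG: (F \subset G) => //=; apply/forall_inP/forall_inP => H v.
    rewrite inE => /andP[vF vG]; apply/forall_inP => u uF.
    have /forall_inP : [forall w in fill B F, (w < v)%O].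
      by apply: H; rewrite !inE vG (negbTE vF) (disjointFr dG vG).
    by apply; rewrite fillE uF.
  rewrite inE fillE negb_or inE => /andP[/andP[vF vB] vGB]; apply/forall_inP => u.
  have Fv (w : E) : w \in F -> (w < v)%O.
    move=> wF; case/orP: vGB => [vG|vB']; last first.
      move: vB; rewrite vB' /= => /exists_inP Hv; rewrite ltNge; apply/negP => vw.
      by apply: Hv; exists w.
    have /forall_inP : [forall u in F, (u < v)%O] by apply: H; rewrite inE vF.
    exact.
  rewrite fillE => /orP[/Fv//|/andP[_ /exists_inP[w wF uw]]].
  exact: le_lt_trans uw (Fv w wF).
move=> G /andP[FG _] GA nBG; rewrite -mulrA H1 //; apply/andP; split=> //.
apply/subsetPn; exists f; first by rewrite (subsetP FG) // fillE fF.
by rewrite (disjointFr dF fF).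
Qed.

(** Against [y B] only sets comparable with B survive. Those strictly containing B contain every i
    in B; their sum is the same for all these i and moves into the value of the linear form. *)
Lemma chow_datum_below A B z y c : B \subset A ->
  chow_datum A z y c ->
  chow_datum B (z * y B) y (fun i => c i - \sum_(G : {set E} | (G \subset A) && (B \proper G)) y G).
Proof.
move=> BA [H1 H2]; split=> [F G FB GB FG|i iB].
  by rewrite mulrAC H1 ?mul0r //; apply: subset_trans BA.
apply/eqP; rewrite mulrBr -[_ == _]/(_ == _ + - _) -subr_eq opprK; apply/eqP.
rewrite -mulrDr; have -> : z * y B * c i = y B * (z * c i) by ring.
rewrite -H2 ?(subsetP BA) // mulrA [y B * z]mulrC.
rewrite [in RHS](bigID (fun G => incomparable B G)) /= [in RHS]mulrDr.
rewrite [X in _ = X + _]mulr_sumr [X in _ = X + _]big1 ?add0r.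
  congr (_ * _); rewrite [RHS](bigID (fun G => G \subset B)) /=; congr (_ + _).
    apply: eq_bigl => G; rewrite /incomparable; case GB: (G \subset B); last by rewrite andbF.
    by rewrite andbF (subset_trans GB BA) /= !andbT.
  apply: eq_bigl => G; rewrite /incomparable properE.
  case GB: (G \subset B); first by rewrite !andbF.
  by rewrite !andbT negbK; case BG: (B \subset G); rewrite ?andbF // (subsetP BG) ?andbT.
by move=> G /andP[/andP[GA _] BG]; rewrite -mulrA H1.
Qed.

Lemma gsum_below A B z y c S : B \subset A -> S \subset B ->
  chow_datum A z y c ->
  z * y B * gsum A y S =
  z * y B * (gsum B y S + \sum_(G | upper A S G && (B \proper G)) y G).
Proof.
move=> BA SB [H1 _]; rewrite /gsum (bigID (fun G => incomparable B G)) /= mulrDr.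
rewrite mulr_sumr [X in X + _]big1 ?add0r => [|G /andP[/and3P[_ GA _] BG]]; last first.
  by rewrite -mulrA H1.
congr (_ * _); rewrite (bigID (fun G => G \subset B)) /=; congr (_ + _).
  apply: eq_bigl => G; rewrite /incomparable /upper; case GB: (G \subset B) => /=.
    by rewrite andbF (subset_trans GB BA) !andbT.
  by rewrite !andbF.
apply: eq_bigl => G; rewrite /incomparable properE; case GB: (G \subset B) => /=.
  by rewrite !andbF.
by rewrite !andbT negbK.
Qed.

Lemma gsum_max A y B a : a \in B -> B \subset A -> {in A, forall u, (u <= a)%O} ->
  gsum A y B = y B.
Proof.
move=> aB BA amax; rewrite /gsum (big_pred1 B) // => G; apply/upperP/eqP.
  move=> [BG GA H]; apply/eqP; rewrite eqEsubset BG andbT; apply/subsetP => v vG.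
  apply: contraT => vB; have := H v a vG vB aB.
  by rewrite ltNge amax // (subsetP GA).
by move=> ->; split=> // v u ->.
Qed.

Lemma prod_join A B a M1 M2 (h : {set E} -> R) : a \in B ->
  normal_family (A :\: B) M1 -> normal_family (B :\ a) M2 ->
  \prod_(S in join B M1 M2) h S =
  h B * (\prod_(F in M1) h (fill B F) * \prod_(S in M2) h S).
Proof.
move=> aB /normal_familyP[M1A _] /normal_familyP[M2B _].
have dF F : F \in M1 -> [disjoint F & B] by case/M1A => /subsetDP[].
have nF F : F \in M1 -> ~~ (fill B F \subset B).
  move=> FM; have [FA F2] := M1A F FM.
  have [f fF] : exists f, f \in F by apply/set0Pn; rewrite -card_gt0; apply: leq_trans F2.
  by apply/subsetPn; exists f; rewrite ?fillE ?fF ?(disjointFr (dF F FM) fF).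
rewrite big_setU1; last first.
  rewrite inE negb_or; apply/andP; split.
    by apply/negP => /M2B[/subsetD1P[_]]; rewrite aB.
  by apply/imsetP => -[F /nF/negP FB BF]; apply: FB; rewrite -BF.
congr (_ * _); under eq_bigl do rewrite in_setU.
rewrite bigU /=; last first.
  rewrite disjoint_sym; apply/pred0P => S /=; apply/negP => /andP[/imsetP[F /nF/negP FB ->]].
  by case/M2B => /subsetD1P[].
rewrite mulrC big_imset //= => F G FM GM FG.
by rewrite -(fillD (dF F FM)) FG fillD ?dF.
Qed.

Lemma eq_prod_mul z M (f h : {set E} -> R) :
  {in M, forall S, z * f S = z * h S} ->
  z * \prod_(S in M) f S = z * \prod_(S in M) h S.
Proof.
move=> H; elim/big_rec2: _ => // S u v SM IH.
by rewrite [RHS]mulrCA -IH mulrA H // -mulrA mulrCA.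
Qed.

(** Factorization of a normal monomial along its member B: g_B is [y B] because B contains max A,
    and against it the g of [fill B F] becomes g_F of the contraction. *)
Lemma prod_contract A B a z y c M1 M2 :
  a \in B -> B \subset A -> {in A, forall u, (u <= a)%O} ->
  chow_datum A z y c ->
  normal_family (A :\: B) M1 -> normal_family (B :\ a) M2 ->
  z * y B * (\prod_(F in M1) gsum (A :\: B) (contract B y) F *
             \prod_(S in M2) gsum A y S) =
  z * \prod_(S in join B M1 M2) gsum A y S.
Proof.
move=> aB BA amax D n1 n2; rewrite (prod_join _ aB n1 n2) (gsum_max _ aB BA amax).
rewrite mulrA [RHS]mulrA [RHS]mulrA; congr (_ * _).
apply: eq_prod_mul => F FM; rewrite (gsum_contract BA _ _ D) //.
  by have [/(_ F FM)[]] := normal_familyP _ _ n1.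
have [/(_ F FM)[_ F2] _] := normal_familyP _ _ n1.
by rewrite -card_gt0; apply: leq_trans F2.
Qed.

End RelativeChow.

(** * Normal monomials span *)

Section Spanning.
Local Open Scope ring_scope.
Context {d : Order.disp_t} {E : finOrderType d} {R : comPzRingType}.
Implicit Types (A B F G S : {set E}) (M : {set {set E}}) (a i : E).
Implicit Types (z w x p q : R) (y g s : {set E} -> R) (c : E -> R) (k : R -> Prop).

(** Scalars are cut out of R by a predicate because the spanning induction enlarges them within
    R. *)
Definition subring k : Prop :=
  [/\ k 1, forall x p, k x -> k p -> k (x - p) & forall x p, k x -> k p -> k (x * p)].

Lemma subring0 k : subring k -> k 0.
Proof. by case=> k1 kB _; rewrite -(subrr 1); apply: kB. Qed.

Lemma subringN k x : subring k -> k x -> k (- x).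
Proof. by move=> K kx; rewrite -sub0r; case: (K) => _ kB _; apply: kB => //; apply: (subring0 K). Qed.

Lemma subringD k x p : subring k -> k x -> k p -> k (x + p).
Proof.
move=> K kx kp; rewrite -[p]opprK; case: (K) => _ kB _; apply: kB => //.
exact: subringN.
Qed.

Inductive alg k y A : R -> Prop :=
| alg_const x : k x -> alg k y A x
| alg_gen F : F != set0 -> F \subset A -> alg k y A (y F)
| alg_add x p : alg k y A x -> alg k y A p -> alg k y A (x + p)
| alg_mul x p : alg k y A x -> alg k y A p -> alg k y A (x * p).

Lemma alg_subring k y A : subring k -> subring (alg k y A).
Proof.
move=> K; have k1 : k 1 by case: K.
split=> [|x p kx kp|x p]; [exact: alg_const| |exact: alg_mul].
apply: alg_add => //; rewrite -mulN1r; apply: alg_mul => //.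
exact: alg_const (subringN K k1).
Qed.

Lemma alg_sum k y A I (r : seq I) (P : pred I) (f : I -> R) : subring k ->
  (forall j, P j -> alg k y A (f j)) -> alg k y A (\sum_(j <- r | P j) f j).
Proof.
move=> K H; elim/big_ind: _ => //; last exact: alg_add.
exact: alg_const (subring0 K).
Qed.

Lemma algS k y A A' x : A \subset A' -> alg k y A x -> alg k y A' x.
Proof.
move=> AA'; elim=> [p kp|F F0 FA|p q _ IHp _ IHq|p q _ IHp _ IHq].
- exact: alg_const.
- by apply: alg_gen => //; apply: subset_trans AA'.
- exact: alg_add.
- exact: alg_mul.
Qed.

Inductive span k z A g : R -> Prop :=
| span_base M b : normal_family A M -> k b -> span k z A g (b * \prod_(S in M) g S)
| span0 : span k z A g 0
| span_add x p : span k z A g x -> span k z A g p -> span k z A g (x + p)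
| span_eq x p : span k z A g x -> z * x = z * p -> span k z A g p.

(* Expanding g = (g + s) - s: submonomials of normal monomials are normal. *)
Lemma span_shift k z A g s x : subring k -> (forall S, k (s S)) ->
  span k z A g x -> span k z A (fun S => g S + s S) x.
Proof.
move=> K ks; have [_ _ kM] := K.
elim=> [M b n kb||p q _ IHp _ IHq|p q _ IHp e]; last first.
- exact: span_eq IHp e.
- exact: span_add.
- exact: span0.
(* N holds the indices already shifted, M' those still to be expanded; each expansion moves one
   index S into N or drops it with scalar [- s S]. *)
suff H n' (N M' : {set {set E}}) b' : (#|M'| < n')%N -> [disjoint N & M'] -> normal_family A (N :|: M') ->
    k b' -> span k z A (fun S => g S + s S)
      (b' * (\prod_(S in N) (g S + s S) * \prod_(S in M') g S)).
  have := H #|M|.+1 set0 M b; rewrite big_set0 mul1r set0U; apply=> //.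
  by rewrite -setI_eq0 set0I.
elim: n' N M' b' => // n' IH N M' b' /ltnSE cM dNM nNM kb'.
have [->|/set0Pn[S SM]] := eqVneq M' set0.
  rewrite big_set0 mulr1; apply: span_base => //.
  by apply: normal_family_sub nNM; apply: subsetUl.
have SN : S \notin N by rewrite (disjointFl dNM SM).
have -> : b' * (\prod_(T in N) (g T + s T) * \prod_(T in M') g T) =
    b' * (\prod_(T in S |: N) (g T + s T) * \prod_(T in M' :\ S) g T) +
    (- (b' * s S)) * (\prod_(T in N) (g T + s T) * \prod_(T in M' :\ S) g T).
  by rewrite (big_setD1 S SM) /= big_setU1 //=; ring.
have cM' : (#|M' :\ S| < n')%N by move: cM; rewrite (cardsD1 S) SM.
have d' : [disjoint N & M' :\ S].
  by apply: disjointWr dNM; apply: subsetDl.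
apply: span_add; apply: IH => //.
- rewrite -setI_eq0; apply/eqP/setP => T; rewrite !inE.
  by case: eqVneq => //= _; have /pred0P/(_ T) := dNM.
- by rewrite -setUA setUCA setD1K.
- by apply: normal_family_sub nNM; rewrite setUS // subsetDl.
- exact: subringN K (kM _ _ kb' (ks S)).
Qed.

Lemma contract_setD B G y : B \subset G -> contract B y (G :\: B) = y G.
Proof. by move=> BG; rewrite /contract setUC -{1}(setIidPr BG) setID. Qed.

Section SplitMax.
Variables (k : R -> Prop) (z : R) (A : {set E}) (y : {set E} -> R) (c : E -> R) (a : E).
Hypotheses (K : subring k) (D : chow_datum A z y c) (kc : forall i, k (c i)).
Hypotheses (aA : a \in A) (amax : {in A, forall u, (u <= a)%O}).

(* Normal forms with respect to a = max A: combinations of elements of CH(A :\ a) and of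
   x_B * CH(A :\: B) * CH(B :\ a). *)
Inductive lifted : R -> Prop :=
| lifted_low p : alg k (pull a y) (A :\ a) p -> lifted p
| lifted_high B p q : a \in B -> B \subset A -> (2 <= #|B|)%N ->
    alg k (contract B y) (A :\: B) p -> alg k (pull a y) (B :\ a) q ->
    lifted (y B * p * q)
| lifted_add x p : lifted x -> lifted p -> lifted (x + p)
| lifted_eq x p : lifted x -> z * x = z * p -> lifted p.

Let k1 : k 1. Proof. by case: K. Qed.

Lemma lifted0 : lifted 0.
Proof. exact: lifted_low (alg_const _ _ (subring0 K)). Qed.

Lemma lifted_sum I (r : seq I) (P : pred I) (f : I -> R) :
  (forall j, P j -> lifted (f j)) -> lifted (\sum_(j <- r | P j) f j).
Proof. by move=> H; elim/big_ind: _ => //; [apply: lifted0|apply: lifted_add]. Qed.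

Lemma incomp0 F G x : F \subset A -> G \subset A -> incomparable F G ->
  z * (y F * y G * x) = 0.
Proof. by case: D => H _ FA GA FG; rewrite mulrA H ?mul0r. Qed.

(** Against [y B] there are three positions of F. Inside B, it joins the factor q. If it is not
    inside B but contains [B :\ a], only [y (a |: F)] survives and it joins p. Otherwise both terms
    of [pull] are incomparable with B. *)
Lemma lifted_pull x F : F != set0 -> F \subset A :\ a ->
  lifted x -> lifted (x * pull a y F).
Proof.
move=> F0 FAa; have /subsetD1P[FA aF] := FAa.
elim=> [p ap|B p q aB BA B2 ap aq|p q _ IHp _ IHq|p q _ IHp e]; last first.
- by apply: lifted_eq IHp _; rewrite !mulrA e.
- by rewrite mulrDl; apply: lifted_add.
- have [FB|nFB] := boolP (F \subset B).
    rewrite -mulrA; apply: lifted_high => //; apply: alg_mul => //.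
    by apply: alg_gen => //; rewrite subsetD1 FB.
  have [Ba|BFa] := boolP (B :\ a \subset F).
    have BaF : B \subset a |: F by rewrite -(setD1K aB) setUS.
    apply: (@lifted_eq (y B * (p * contract B y ((a |: F) :\: B)) * q)).
      apply: lifted_high => //; apply: alg_mul => //; apply: alg_gen.
        have [f fF fB] := subsetPn nFB.
        by apply/set0Pn; exists f; rewrite !inE fF fB orbT.
      by apply: setSD; rewrite subUset sub1set aA.
    rewrite contract_setD // /pull.
    have H : z * (y B * y F * (p * q)) = 0.
      apply: incomp0 => //; rewrite /incomparable nFB andbT.
      by apply/subsetPn; exists a.
    have -> : z * (y B * p * q * (y F + y (a |: F))) =
      z * (y B * y F * (p * q)) + z * (y B * (p * y (a |: F)) * q) by ring.
    by rewrite H add0r.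
  apply: lifted_eq lifted0 _; rewrite mulr0 /pull.
  have -> : z * (y B * p * q * (y F + y (a |: F))) =
      z * (y B * y F * (p * q)) + z * (y B * y (a |: F) * (p * q)) by ring.
  have [f fF fB] := subsetPn nFB; have [b bB bF] := subsetPn BFa.
  move: bB; rewrite inE => /andP[ba bB].
  rewrite !incomp0 ?addr0 //; try (apply/incomparableP; split).
  + by rewrite subUset sub1set aA.
  + by exists b; rewrite // in_setU negb_or ba.
  + by exists f; rewrite // !inE fF orbT.
  + by exists b.
  by exists f.
- apply/lifted_low/alg_mul => //; exact: alg_gen.
Qed.

Lemma lifted_scale b x : k b -> lifted x -> lifted (x * b).
Proof.
move=> kb; elim=> [p ap|B p q aB BA B2 ap aq|p q _ IHp _ IHq|p q _ IHp e].
- by apply/lifted_low/alg_mul => //; apply: alg_const.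
- by rewrite -mulrA; apply: lifted_high => //; apply: alg_mul => //; apply: alg_const.
- by rewrite mulrDl; apply: lifted_add.
- by apply: lifted_eq IHp _; rewrite !mulrA e.
Qed.

Lemma lifted_mul_low x q : alg k (pull a y) (A :\ a) q -> lifted x -> lifted (x * q).
Proof.
move=> aq; elim: aq x => {q} [q kq|F F0 FA|p q _ IHp _ IHq|p q _ IHp _ IHq] x lx.
- exact: lifted_scale.
- exact: lifted_pull.
- by rewrite mulrDr; apply: lifted_add; [apply: IHp|apply: IHq].
- by rewrite mulrA; apply/IHq/IHp.
Qed.

Lemma lifted_gen B : a \in B -> B \subset A -> (2 <= #|B|)%N -> lifted (y B).
Proof.
move=> aB BA B2; rewrite -[y B]mulr1 -[y B * 1]mulr1.
by apply: lifted_high => //; apply: alg_const.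
Qed.

Lemma lifted_opp x : lifted x -> lifted (- x).
Proof.
by move=> lx; rewrite -mulrN1; apply: lifted_scale => //; apply: (subringN K).
Qed.

(** The linear relation at a, solved for [y B]. It removes the two factors without a normal form of
    their own: [y [set a]], and a second factor [y B]. *)
Lemma linear_rel x B : a \in B -> B \subset A ->
  z * (y B * x) = z * (c a * x +
    \sum_(C : {set E} | [&& C \subset A, a \in C & C != B]) - (y C * x)).
Proof.
move=> aB BA; have [_ /(_ a aA)] := D; rewrite (bigD1 B) ?BA //= => H.
rewrite sumrN -mulr_suml mulrBr mulrA [z * (c a * x)]mulrA -H.
rewrite (eq_bigl (fun C : {set E} => [&& C \subset A, a \in C & C != B])).
  ring.
by move=> C; rewrite andbA.
Qed.

Lemma lifted_contract B p : a \in B -> B \subset A ->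
  alg k (contract B y) (A :\: B) p -> lifted (y B * p).
Proof.
move=> aB BA ap; have [B2|] := leqP 2 #|B|.
  rewrite -[y B * p]mulr1; apply: lifted_high => //; exact: alg_const.
rewrite ltnS (cardsD1 a) aB ltnS leqn0 cards_eq0 => /eqP Ba.
have {}Ba : B = [set a] by rewrite -(setD1K aB) Ba setU0.
(* Against [y [set a]] the term [y F] of [pull a y F] vanishes by incomparability, so contraction by
   the singleton agrees with [pull]. *)
subst B; have [q aq e] : exists2 q, alg k (pull a y) (A :\ a) q &
    z * (y [set a] * q) = z * (y [set a] * p).
  elim: ap => {p} [p kp|F F0 FA|p p' _ [q aq e] _ [q' aq' e']|p p' _ [q aq e] _ [q' aq' e']].
  - by exists p => //; apply: alg_const.
  - exists (pull a y F); first exact: alg_gen.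
    have /subsetD1P[FA' aF] := FA.
    have [f fF] := set0Pn _ F0.
    rewrite /contract /pull [F :|: _]setUC mulrDr mulrDr -[y _ * y F]mulr1 incomp0 ?add0r //.
    apply/incomparableP; split; first by exists a; rewrite ?inE.
    by exists f; rewrite // inE; apply: contraNneq aF => <-.
  - by exists (q + q'); [exact: alg_add | rewrite !mulrDr e e'].
  - exists (q * q'); first exact: alg_mul.
    have -> : z * (y [set a] * (q * q')) = (z * (y [set a] * q)) * q' by ring.
    rewrite e; have -> : z * (y [set a] * p) * q' = p * (z * (y [set a] * q')) by ring.
    by rewrite e'; ring.
apply: lifted_eq e; apply: lifted_mul_low => //.
apply: (@lifted_eq (c a * 1 +
    \sum_(C : {set E} | [&& C \subset A, a \in C & C != [set a]]) - (y C * 1))).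
  apply: lifted_add; first by apply/lifted_low/alg_const; rewrite mulr1.
  apply: lifted_sum => C /and3P[CA aC Ca]; rewrite mulr1; apply/lifted_opp/lifted_gen => //.
  rewrite (cardsD1 a) aC ltnS lt0n cards_eq0; apply: contraNneq Ca => e0.
  by rewrite -(setD1K aC) e0 setU0.
by rewrite -linear_rel ?mulr1.
Qed.

(** For comparable B and C with C different from B, the smaller set takes the leading role: if it is
    C, contraction by B is rewritten as contraction by C. The case C = B is traded, by the linear
    relation at a, for sets other than B. *)
Lemma lifted_mul_max x (C : {set E}) : a \in C -> C \subset A -> lifted x -> lifted (x * y C).
Proof.
move=> aC CA; elim=> [p ap|B p q aB BA B2 ap aq|p q _ IHp _ IHq|p q _ IHp e]; last first.
- by apply: lifted_eq IHp _; rewrite !mulrA e.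
- by rewrite mulrDl; apply: lifted_add.
- have aq' : alg k (pull a y) (A :\ a) q by apply: algS aq; apply: setSD.
  have neqC (C' : {set E}) : C' \subset A -> a \in C' -> C' != B -> lifted (y B * p * y C' * q).
    move=> C'A aC' C'B; apply: lifted_mul_low => //.
    have [BC|nBC] := boolP (B \subset C').
      rewrite -mulrA -(contract_setD y BC).
        apply: lifted_contract => //; apply: alg_mul => //; apply: alg_gen.
          by rewrite setD_eq0; apply: contraNN C'B => CB; rewrite eqEsubset CB.
        exact: setSD.
    have [CB|nCB] := boolP (C' \subset B); last first.
      apply: lifted_eq lifted0 _; rewrite mulr0 [y B * p * _]mulrAC incomp0 //.
      by rewrite /incomparable nBC.
    rewrite mulrC -(contract_setD y CB).
      apply: lifted_contract => //; apply: alg_mul.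
        by apply: alg_gen; [rewrite setD_eq0 | apply: setSD].
      elim: ap => {p} [p kp|F F0 FA|p p' _ IHp _ IHq|p p' _ IHp _ IHq].
      + exact: alg_const.
      + have [f fF] := set0Pn _ F0; have [FA' dF] := subsetDP FA.
        have -> : contract B y F = contract C' y (F :|: (B :\: C')).
          rewrite /contract -setUA; congr (y (_ :|: _)); apply/setP => v.
          by rewrite !inE; have := subsetP CB v; case: (v \in C') => [->|_] //; rewrite orbF.
        apply: alg_gen; first by apply/set0Pn; exists f; rewrite !inE fF.
        rewrite subUset setSD // andbT; apply: subset_trans FA _.
        exact: setDS.
      + exact: alg_add.
      + exact: alg_mul.
  have -> : y B * p * q * y C = y B * p * y C * q by ring.
  have [->|] := eqVneq C B; last exact: neqC.
  apply: (@lifted_eq (c a * (y B * p * q) + \sum_(C : {set E} | [&& C \subset A, a \in C & C != B])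
        - (y C * (y B * p * q)))).
    apply: lifted_add; first by rewrite mulrC; apply: lifted_scale => //; apply: lifted_high.
    apply: lifted_sum => C' /and3P[C'A aC' C'B]; apply: lifted_opp.
    have -> : y C' * (y B * p * q) = y B * p * y C' * q by ring.
    exact: neqC.
  by rewrite -linear_rel //; ring.
rewrite mulrC; apply: lifted_mul_low => //; rewrite -[y C]mulr1.
by apply: lifted_contract => //; apply: alg_const.
Qed.

Lemma lifted_alg p : alg k y A p -> lifted p.
Proof.
move=> ap; rewrite -[p]mul1r; have : lifted 1 by apply/lifted_low/alg_const.
move: 1; elim: ap => {p} [p kp|F F0 FA|p q _ IHp _ IHq|p q _ IHp _ IHq] x lx.
- exact: lifted_scale.
- have [aF|aF] := boolP (a \in F); first exact: lifted_mul_max.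
  have -> : y F = pull a y F - y (a |: F) by rewrite /pull addrK.
  rewrite mulrBr; apply: lifted_add; first by apply: lifted_pull; rewrite // subsetD1 FA.
  apply/lifted_opp/lifted_mul_max => //; first exact: setU11.
  by rewrite subUset sub1set aA.
- by rewrite mulrDr; apply: lifted_add; [apply: IHp|apply: IHq].
- by rewrite mulrA; apply/IHq/IHp.
Qed.

End SplitMax.

(* Perturbing each g_S by a scalar s S makes the induction go through: after multiplication by
   y B, the g_S of A and of B :\ a, as well as the values of their linear forms, differ by
   elements of the ring generated by the y G with B \proper G, which is taken as the ring of
   scalars for B :\ a. *)
Theorem spanning A k z y c s : subring k -> chow_datum A z y c ->
  (forall i, k (c i)) -> (forall S, k (s S)) ->
  forall p, alg k y A p -> span k z A (fun S => gsum A y S + s S) p.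
Proof.
have [n] := ubnP #|A|; elim: n A k z y c s => // n IH A k z y c s /ltnSE An K D kc ks p ap.
apply: span_shift => //.
have [A0|/set_max[a aA amax]] := eqVneq A set0.
  have : k p.
    elim: ap => {p} // [F F0|p q _ kp _ kq|p q _ kp _ kq].
    - by rewrite A0 subset0 (negbTE F0).
    - exact: (subringD K).
    - by case: K => _ _; apply.
  by move=> kp; have := span_base z (gsum A y) (normal_family_set0 A) kp; rewrite big_set0 mulr1.
have ltA A' : A' \subset A :\ a -> (#|A'| < n)%N.
  move=> /subset_leq_card; rewrite -ltnS => /leq_trans; apply.
  by move: An; rewrite (cardsD1 a) aA.
have kM : forall x p, k x -> k p -> k (x * p) by case: K.
elim: (lifted_alg K D kc aA ap) => {p ap} [p ap|B p q aB BA B2 ap aq|p q _ IHp _ IHq|p q _ IHp e].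
- have := IH _ _ _ _ _ (fun=> 0) (ltA _ (subxx _)) K (chow_datum_pull aA D) kc
            (fun=> subring0 K) p ap.
  elim=> {p ap} [M b n' kb||p q _ IHp _ IHq|p q _ IHp e].
  + rewrite (_ : \prod_(S in M) _ = \prod_(S in M) gsum A y S).
      by apply: span_base => //; apply: normal_familyS n'; apply: subsetDl.
    apply: eq_bigr => S SM; rewrite addr0; apply: gsum_pull => //.
    by have [/(_ S SM)[]] := normal_familyP _ _ n'.
  + exact: span0.
  + exact: span_add.
  + exact: span_eq IHp e.
- have K' := alg_subring (contract B y) (A :\: B) K.
  have aBmax : {in B, forall u, (u <= a)%O} by move=> u /(subsetP BA); apply: amax.
  have ltAB : (#|A :\: B| < n)%N.
    apply: ltA; apply/subsetP => v; rewrite !inE => /andP[vB ->]; rewrite andbT.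
    by apply: contraNneq vB => ->.
  have ltB : (#|B :\ a| < n)%N by apply: ltA; apply: setSD.
  pose K'' := alg k (contract B y) (A :\: B).
  have abv G : G \subset A -> B \proper G -> K'' (y G).
    move=> GA /properP[BG [f fG fB]].
    rewrite -(contract_setD y BG).
    by apply: alg_gen; [apply/set0Pn; exists f; rewrite inE fB | apply: setSD].
  have DB := chow_datum_below BA D.
  have aq' := IH _ K'' _ _ _
    (fun S => \sum_(G | upper A S G && (B \proper G)) y G) ltB K' (chow_datum_pull aB DB) _ _ q _.
  have {}aq' : span K'' (z * y B) (B :\ a) (fun S => gsum (B :\ a) (pull a y) S +
      \sum_(G | upper A S G && (B \proper G)) y G) q.
    apply: aq'.
    + move=> i; apply: (subringD K'); first exact: alg_const.
      apply: (subringN K'); apply: alg_sum => // G /andP[GA BG]; exact: abv.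
    + by move=> S; apply: alg_sum => // G /andP[/and3P[_ GA _] BG]; apply: abv.
    + elim: aq => {q} [q kq|F F0 FA|q q' _ IHp _ IHq|q q' _ IHp _ IHq].
      * by apply/alg_const/alg_const.
      * exact: alg_gen.
      * exact: alg_add.
      * exact: alg_mul.
  elim: aq' p ap => {q aq} [M2 b n2 kb||q q' _ IHp _ IHq|q q' _ IHp e] p ap.
  (* Against [z * y B], the perturbed generators on [B :\ a] are the g_S of A. *)
  + apply: (@span_eq _ _ _ _ (y B * (p * b) * \prod_(S in M2) gsum A y S)); last first.
      have -> : z * (y B * (p * b) * \prod_(S in M2) gsum A y S) =
        p * b * (z * y B * \prod_(S in M2) gsum A y S) by ring.
      rewrite (eq_prod_mul (h := fun S => gsum (B :\ a) (pull a y) S +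
                \sum_(G | upper A S G && (B \proper G)) y G)); first by ring.
      move=> S SM; have [/(_ S SM)[SB _] _] := normal_familyP _ _ n2.
      rewrite gsum_pull // (gsum_below BA _ D) //.
      by apply: subset_trans SB (subsetDl _ _).
    (* The coefficient b from the expansion of q lies in the contracted algebra, so it is absorbed
       into p before p is expanded on [A :\: B]. The product over M2 joins the multiplier, since it
       multiplies every term of that expansion. *)
    have apb : K'' (p * b) by apply: alg_mul.
    have B0 : B != set0 by apply/set0Pn; exists a.
    have := IH _ _ _ _ _ (fun=> 0) ltAB K (chow_datumM (\prod_(S in M2) gsum A y S)
       (chow_datum_contract BA B0 D)) kc (fun=> subring0 K) _ apb.
    elim=> {p ap b kb apb} [M1 b n1 kb||p q _ IHp _ IHq|p q _ IHp e].
    * apply: (@span_eq _ _ _ _ (b * \prod_(S in join B M1 M2) gsum A y S)).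
        apply: span_base => //; exact: (join_normal BA aB amax).
      rewrite mulrCA -(prod_contract aB BA amax D n1 n2).
      rewrite [in RHS](eq_bigr (gsum (A :\: B) (contract B y))) => [|S _]; last by rewrite addr0.
      ring.
    * by rewrite mulr0 mul0r; apply: span0.
    * by rewrite mulrDr mulrDl; apply: span_add.
    * apply: span_eq IHp _.
      have r x : z * (y B * x * \prod_(S in M2) gsum A y S) =
         z * y B * \prod_(S in M2) gsum A y S * x by ring.
      by rewrite !r.
  + by rewrite mulr0; apply: span0.
  + by rewrite mulrDr; apply: span_add; [apply: IHp|apply: IHq].
  + apply: span_eq (IHp p ap) _; have r x : z * (y B * p * x) = p * (z * y B * x) by ring.
    by rewrite !r e.
- exact: span_add.
- exact: span_eq IHp e.
Qed.

Lemma span_coef k z A g x : subring k -> span k z A g x ->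
  exists b : {set {set E}} -> R, (forall M, k (b M)) /\
    z * x = z * \sum_(M | normal_family A M) b M * \prod_(S in M) g S.
Proof.
move=> K; elim=> [M b n kb||p q _ [b [kb e]] _ [b' [kb' e']]|p q _ [b [kb e]] <-].
- exists (fun N => if N == M then b else 0); split.
    by move=> N; case: ifP => // _; apply: (subring0 K).
  rewrite (bigD1 M) //= eqxx [X in _ + X]big1 ?addr0 // => N /andP[_ /negbTE->].
  by rewrite mul0r.
- exists (fun=> 0); split=> [M|]; first exact: (subring0 K).
  by rewrite big1 // => M _; rewrite mul0r.
- exists (fun M => b M + b' M); split=> [M|]; first exact: (subringD K).
  rewrite mulrDr e e' -mulrDr -big_split; congr (_ * _); apply: eq_bigr => M _.
  by rewrite mulrDl.
- by exists b.
Qed.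

End Spanning.

(** * Multiplication by the top generator *)

Section Step.

(* The recursion of the theorem on codes; None is the symbol 0. *)
Inductive step : seq nat -> option (seq nat) -> Prop :=
| step_single : step [:: 0%N] None
| step_last e : e != [::] -> step (rcons e 0%N) (Some (0%N :: map S e))
| step_first e r : e != [::] -> step e r ->
    step (0%N :: map S e) (omap (fun e' => 0%N :: map S e') r)
| step_mid e1 e2 r : e1 != [::] -> e2 != [::] -> all (fun k => k != 0%N) e2 ->
    step e1 r -> step (e1 ++ 0%N :: e2) (omap (fun e' => e' ++ 0%N :: e2) r).

Lemma size_step e r : step e r -> if r is Some e' then size e' = size e else True.
Proof.
elim=> {e r} [|e _|e [e'|] _ _ IH|e1 e2 [e'|] _ _ _ _ IH] //=.
- by rewrite size_rcons size_map.
- by rewrite !size_map IH.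
- by rewrite !size_cat IH.
Qed.

Definition invseq (e : seq nat) : Prop := forall i, (nth 0%N e i <= i)%N.

Lemma last_zero (e : seq nat) : 0%N \in e ->
  exists e1 e2, e = e1 ++ 0%N :: e2 /\ all (fun k => k != 0%N) e2.
Proof.
elim/last_ind: e => // e x IH; rewrite mem_rcons inE.
have [->|x0] := eqVneq x 0%N; first by exists e, [::]; rewrite cats1.
rewrite /= => /IH[e1 [e2 [-> a2]]]; exists e1, (rcons e2 x).
by rewrite rcons_cat rcons_cons all_rcons x0 a2.
Qed.

(** The first entry is 0, so there is a last zero; what precedes and follows it selects the rule. *)
Lemma step_total e : e != [::] -> invseq e -> exists r, step e r.
Proof.
have [n] := ubnP (size e); elim: n e => // n IH e /ltnSE en eN inv.
have [|e1 [e2 [ee a2]]] := @last_zero e.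
  by case: e {en} eN inv => // x e _ /(_ 0%N) /=; rewrite leqn0 => /eqP->; apply: mem_head.
subst e; rewrite size_cat /= addnS in en.
have [e1N|e1N] := eqVneq e1 [::]; have [e2N|e2N] := eqVneq e2 [::].
- by exists None; rewrite e1N e2N; apply: step_single.
- have [|||r sr] := IH (map predn e2).
  + by rewrite size_map; apply: leq_trans en; rewrite ltnS leq_addl.
  + by case: (e2) e2N.
  + move=> i; have [ie|ie] := ltnP i (size e2); last by rewrite nth_default ?size_map.
    rewrite (nth_map 0%N) // -ltnS prednK; first by have := inv i.+1; rewrite e1N.
    by rewrite lt0n; apply: (all_nthP 0%N a2).
  exists (omap (fun e' => 0%N :: map S e') r).
  rewrite e1N cat0s -[e2](_ : map S (map predn e2) = e2).
    by apply: step_first => //; case: (e2) e2N.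
  rewrite -map_comp -[RHS]map_id; apply/eq_in_map => k /(allP a2) /=.
  by case: k.
- exists (Some (0%N :: map S e1)); rewrite e2N cats1; exact: step_last.
have [||r sr] := IH e1 _ e1N.
- by apply: leq_trans en; rewrite ltnS leq_addr.
- move=> i; have [ie|ie] := ltnP i (size e1); last by rewrite nth_default.
  by have := inv i; rewrite nth_cat ie.
by exists (omap (fun e' => e' ++ 0%N :: e2) r); apply: step_mid.
Qed.

Context {d : Order.disp_t} {E : finOrderType d}.
Implicit Types (s p : seq E) (A B : {set E}).

Lemma invseq_code s : invseq (code s).
Proof.
suff H p i : (nth 0%N (code_aux p s) i <= size p + i)%N by move=> i; apply: (H [::]).
elim: s p i => [|x s IH] p [|i] //=; first by rewrite addn0 count_size.
by apply: leq_trans (IH _ _) _; rewrite /= addSnnS.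
Qed.

Lemma rank_exists A v : (v < #|A|)%N ->
  exists2 x, x \in A & #|[set y in A | (x < y)%O]| = v.
Proof.
elim: v A => [|v IH] A vA.
  have [|a aA amax] := @set_max _ _ A; first by rewrite -card_gt0.
  exists a => //; apply/eqP; rewrite cards_eq0; apply/eqP/setP => y; rewrite !inE.
  by apply/negbTE/andP => -[/amax]; rewrite leNgt => /negbTE->.
have [|a aA amax] := @set_max _ _ A; first by rewrite -card_gt0; apply: leq_trans vA.
have [|x] := IH (A :\ a); first by move: vA; rewrite (cardsD1 a A) aA.
rewrite !inE => /andP[xa xA] <-; exists x => //.
rewrite (cardsD1 a) !inE aA lt_neqAle xa amax //= add1n; congr _.+1.
by apply: eq_card => y; rewrite !inE; case: eqVneq.
Qed.

(** Decoding from the right: the last entry counts the letters of A exceeding the last letter, which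
    it therefore determines. *)
Lemma code_surj A e : invseq e -> #|A| = size e ->
  exists s, [/\ uniq s, [set v in s] = A & code s = e].
Proof.
elim/last_ind: e A => [|e v IH] A inv cA.
  exists [::]; split=> //; apply/esym/eqP; rewrite -cards_eq0 cA //.
rewrite size_rcons in cA.
have [|x xA xv] := @rank_exists A v.
  by rewrite cA ltnS; have := inv (size e); rewrite nth_rcons ltnn eqxx.
have [||s [us es cs]] := IH (A :\ x).
- move=> i; have := inv i; rewrite nth_rcons; case: ltnP => // ie _.
  by rewrite nth_default.
- by move: cA; rewrite (cardsD1 x) xA => -[].
have ms y : (y \in s) = (y != x) && (y \in A) by move/setP/(_ y): es; rewrite !inE.
exists (rcons s x); split.
- by rewrite rcons_uniq us ms eqxx.
- by apply/setP => y; rewrite inE mem_rcons inE ms; case: eqVneq => // ->.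
rewrite -cats1 /code code_aux_cat /= -/(code s) cs cats1 cats0 count_rev; congr rcons.
rewrite -xv -size_filter -(card_uniqP _) ?filter_uniq //.
apply: eq_card => y; rewrite mem_filter ms !inE; case: eqVneq => [->|_] /=.
  by rewrite ltxx !andbF.
by rewrite andbC.
Qed.

End Step.

Section Multiplication.
Local Open Scope ring_scope.
Context {d : Order.disp_t} {E : finOrderType d} {R : comPzRingType}.
Implicit Types (A B F G S : {set E}) (a i : E) (s : seq E).
Implicit Types (z w x p q : R) (y g : {set E} -> R).

Lemma perm_set s s' : perm_eq s s' -> [set v in s] = [set v in s'].
Proof. by move=> ss'; apply/setP => v; rewrite !inE (perm_mem ss'). Qed.

Definition fprod A y s : R := \prod_(S in word_family s) gsum A y S.

(** Multiply the linear relation at a by [y (A :\ a)]: a set containing a, other than A, is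
    incomparable with [A :\ a]. *)
Lemma top_relation A z y a : a \in A ->
  chow_datum A z y (fun=> 0) -> z * (y A * y (A :\ a)) = 0.
Proof.
move=> aA [H1 H2]; have := H2 a aA; rewrite mulr0 => H.
suff -> : z * (y A * y (A :\ a)) =
    y (A :\ a) * (z * \sum_(F : {set E} | (F \subset A) && (a \in F)) y F).
  by rewrite H mulr0.
rewrite mulrCA mulr_sumr mulr_sumr (bigD1 A) ?subxx //= big1 ?addr0.
  by ring.
move=> F /andP[/andP[FA aF] FA']; rewrite mulrCA H1 ?subsetDl //.
rewrite /incomparable andbC; apply/andP; split.
  by apply/subsetPn; exists a; rewrite ?setD11.
apply: contraNN FA' => sF; rewrite eqEsubset FA -(setD1K aA) subUset sub1set aF.
exact: sF.
Qed.

Lemma gsum_top A y : gsum A y A = y A.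
Proof.
rewrite /gsum (big_pred1 A) // => G; rewrite /upper.
apply/and3P/eqP => [[AG GA _]|->]; first by apply/eqP; rewrite eqEsubset GA.
by split=> //; apply/forall_inP => v; rewrite setDv inE.
Qed.

Lemma fprod_first a s A y : [set v in a :: s] = A -> uniq (a :: s) ->
  {in s, forall u, (u < a)%O} -> s != [::] -> fprod A y (a :: s) = y A * fprod A y s.
Proof.
move=> eA us sa sN; rewrite /fprod -[a :: s]cat0s word_family_join //.
rewrite (@prod_join _ _ _ A _ a) ?inE ?eqxx //.
- by rewrite big_set0 mul1r eA gsum_top.
- exact: normal_family_set0.
- by rewrite uniq_setD1 //; apply: word_family_normal; case/andP: us.
Qed.

(** The multiplier is general because the recursive calls use [z * y A] on [A :\ a], and [z * y B]
    times the monomial of s2 on [A :\: B]. *)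
Theorem mul_top e r : step e r -> forall A z y s, uniq s -> [set v in s] = A ->
  code s = e -> chow_datum A z y (fun=> 0) ->
  if r is Some e' then exists s', [/\ perm_eq s' s, code s' = e' &
    z * (y A * fprod A y s) = z * fprod A y s']
  else z * (y A * fprod A y s) = 0.
Proof.
elim=> {e r} [|e eN|e r eN _ IH|e1 e2 r e1N e2N a2 _ IH] A z y s us eA cs D.
- have := size_code_aux [::] s; rewrite -/(code s) cs; case: s us eA {cs} => [|x []] // _ eA _.
  have [_ /(_ x)] := D; rewrite -eA inE mem_head mulr0 /fprod big_set0 mulr1 => <- //.
  rewrite (big_pred1 [set v in [:: x]]) // => F; apply/andP/eqP => [[Fx xF]|->].
    apply/eqP; rewrite eqEsubset Fx; apply/subsetP => v; rewrite !inE => /eqP->//.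
  by rewrite inE mem_head.
- rewrite -cats1 in cs; have [s1 [a [s2 [es z1 z2 [c1 sa]]]]] := code_split_inv us cs isT.
  case: s2 z2 es sa => // _ es; rewrite cats0 => sa.
  have s1N : s1 != [::] by case: (s1) (e) z1 eN => // - [].
  have pe : perm_eq (a :: s1) s by rewrite es perm_sym cats1 perm_rcons.
  exists (a :: s1); split => //; first by rewrite code_max_head // c1.
  rewrite fprod_first //.
  + by rewrite {2}/fprod -(word_family_rcons sa) -cats1 -es.
  + by rewrite -eA; apply: perm_set.
  + by rewrite (perm_uniq pe).
- have pos : all (fun k => k != 0%N) (map S e) by apply/allP => k /mapP[j _ ->].
  have [s1 [a [s2 [es z1 z2 [_ sa]]]]] := @code_split_inv _ _ s [::] _ us cs pos.
  case: s1 z1 es sa => // _ es sa; rewrite size_map in z2.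
  rewrite /= in es sa; subst s.
  have s2N : s2 != [::] by case: (s2) (e) z2 eN => // - [].
  have c2 : code s2 = e.
    move: cs; rewrite code_max_head // => -[/inj_map]; apply; exact: succn_inj.
  have aA : a \in A by rewrite -eA inE mem_head.
  have eA' : [set v in s2] = A :\ a by rewrite -eA uniq_setD1.
  have amax : {in A, forall u, (u <= a)%O}.
    by move=> u; rewrite -eA !inE => /predU1P[->//|/sa]; apply: ltW.
  have us2 : uniq s2 by case/andP: us.
  have D' := chow_datumM (y A) (chow_datum_pull aA D).
  have pullE (p : seq E) : uniq p -> [set v in p] = A :\ a ->
      fprod (A :\ a) (pull a y) p = fprod A y p.
    move=> up ep; apply: eq_bigr => S SM; apply: gsum_pull => //.
    have /normal_familyP[/(_ S SM)[]] := word_family_normal up.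
    by rewrite ep.
  (* Here [pull a y (A :\ a)] is [y (A :\ a) + y A], the top generator of [A :\ a]; its first term
     dies against [y A] by the top relation. *)
  have lhs : z * (y A * fprod A y (a :: s2)) =
      z * y A * (pull a y (A :\ a) * fprod (A :\ a) (pull a y) s2).
    rewrite fprod_first // pullE // /pull setD1K // mulrDl mulrDr.
    have -> : z * y A * (y (A :\ a) * fprod A y s2) =
        z * (y A * y (A :\ a)) * fprod A y s2 by ring.
    by rewrite (top_relation aA D); ring.
  have := IH _ _ _ _ us2 eA' c2 D'; rewrite -lhs.
  case: r {IH} => [e'|] //= [s' [pe ce ->]].
  have us' : uniq s' by rewrite (perm_uniq pe).
  have es' : [set v in s'] = A :\ a.
    by rewrite -eA'; apply: perm_set.
  have sa' : {in s', forall u, (u < a)%O} by move=> u; rewrite (perm_mem pe); apply: sa.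
  exists (a :: s'); split; first by rewrite perm_cons.
    by rewrite code_max_head // ce.
  rewrite fprod_first //.
  + by rewrite mulrA pullE.
  + by rewrite -eA; apply: perm_set; rewrite perm_cons.
  + by rewrite (perm_uniq (_ : perm_eq _ (a :: s2))) // perm_cons.
  + by apply: contraNneq s2N => s'0; rewrite -size_eq0 -(perm_size pe) s'0.
have [s1 [a [s2 [es z1 z2 [c1 sa]]]]] := code_split_inv us cs a2; subst s.
have s1N : s1 != [::] by case: (s1) (e1) z1 e1N => // - [].
have s2N : s2 != [::] by case: (s2) (e2) z2 e2N => // - [].
have s1a : {in s1, forall u, (u < a)%O} by move=> u us1; apply: sa; rewrite mem_cat us1.
have ce2 : code_aux (a :: s1) s2 = e2.
  move: cs; rewrite code_split // => /eqP; rewrite eqseq_cat ?size_code_aux //.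
  by case/andP=> _ /eqP[].
pose B := [set v in a :: s2].
have aB : a \in B by rewrite inE mem_head.
have BA : B \subset A.
  by rewrite -eA; apply/subsetP => v; rewrite !inE mem_cat inE => ->; rewrite orbT.
have B0 : B != set0 by apply/set0Pn; exists a.
have amax : {in A, forall u, (u <= a)%O}.
  move=> u; rewrite -eA inE mem_cat inE orbCA -mem_cat => /predU1P[->//|/sa]; exact: ltW.
have [us1 us2] : uniq s1 /\ uniq (a :: s2) by move: us; rewrite cat_uniq => /and3P[].
have eAB : [set v in s1] = A :\: B by rewrite -eA uniq_setD.
have n2 : normal_family (B :\ a) (word_family s2).
  by rewrite uniq_setD1 //; apply: word_family_normal; case/andP: us2.
have D' := chow_datumM (fprod A y s2) (chow_datum_contract BA B0 D).
have prodE (p : seq E) : perm_eq p s1 -> z * fprod A y (p ++ a :: s2) =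
    z * y B * fprod A y s2 * fprod (A :\: B) (contract B y) p.
  move=> pe; rewrite {1}/fprod word_family_join //; last first.
    by move=> u; rewrite mem_cat (perm_mem pe) -mem_cat; apply: sa.
  rewrite -(prod_contract aB BA amax D) // -/(fprod _ _ _).
    by rewrite /fprod; ring.
  by rewrite -eAB -(perm_set pe); apply: word_family_normal; rewrite (perm_uniq pe).
(* [y A] is itself the top generator of the contraction, namely [contract B y (A :\: B)]. *)
have lhs : z * (y A * fprod A y (s1 ++ a :: s2)) = z * y B * fprod A y s2 *
    (contract B y (A :\: B) * fprod (A :\: B) (contract B y) s1).
  by rewrite mulrCA prodE // contract_setD //; ring.
have := IH _ _ _ _ us1 eAB c1 D'; rewrite -lhs.
case: r {IH} => [e'|] //= [s' [pe ce ->]].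
exists (s' ++ a :: s2); split; first by rewrite perm_cat2r.
  rewrite code_split ?ce => [|u]; last by rewrite (perm_mem pe); apply: s1a.
  by rewrite -ce2 (@eq_code_aux _ _ (a :: s') (a :: s1)) // perm_cons.
by rewrite prodE.
Qed.

End Multiplication.

(** Functions on the set of points form the ring to which [spanning] is applied. *)
HB.instance Definition _ (aT : finType) (R : comPzRingType) :=
  GRing.PzRing_hasCommutativeMul.Build {ffun aT -> R} (@ffun_mulC aT R).

(** * Linear independence *)

Section Points.
Local Open Scope ring_scope.
Context {d : Order.disp_t} {E : finOrderType d}.
Implicit Types (F G S : {set E}) (s : seq E) (t u : arrangement E).

Definition word t : seq E := codom (val t).

Lemma word_uniq t : uniq (word t).
Proof. by rewrite map_inj_uniq ?enum_uniq //; apply/injectiveP; case: t. Qed.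

Lemma size_word t : size (word t) = #|E|.
Proof. by rewrite size_codom card_ord. Qed.

Lemma mem_word t x : x \in word t.
Proof.
have /subset_cardP : #|word t| = #|E| by rewrite (card_uniqP (word_uniq t)) size_word.
by move=> /(_ (subset_predT _))/(_ x).
Qed.

Lemma nth_word t (i : 'I_#|E|) x0 : nth x0 (word t) i = val t i.
Proof. by rewrite /word codomE (nth_map i) ?size_enum_ord // nth_ord_enum. Qed.

Lemma word_inj : injective word.
Proof.
move=> t u tu; apply/val_inj/ffunP => i.
by rewrite -(nth_word t i (val t i)) tu nth_word.
Qed.

Lemma word_surj s : uniq s -> size s = #|E| -> exists t, word t = s.
Proof.
move=> us /eqP ss; pose f : {ffun 'I_#|E| -> E} := [ffun i => tnth (Tuple ss) i].
have inj : injectiveb f.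
  by apply/injectiveP => i j; rewrite !ffunE; apply/tuple_uniqP.
exists (exist (fun f : {ffun 'I_#|E| -> E} => injectiveb f) f inj); rewrite /word codomE /=.
by rewrite (eq_map (ffunE _)) map_tnth_enum.
Qed.

(** The shift by one keeps the weights away from 0, the default that [nth] returns past the last
    letter; hence the last jump is nonzero too. *)
Definition weight (x : E) : rat := (enum_rank x).+1%:R.

Definition prefix_set s (k : nat) : {set E} := [set v in take k.+1 s].

(* The point of the deformed Chow ring attached to s: x_F vanishes off the flag of prefix
   sets of s, and each sum of the x_F over the F containing i takes the value weight i * 'X. *)
Definition jump s (k : nat) : {poly rat} :=
  'X * (nth 0 (map weight s) k - nth 0 (map weight s) k.+1)%:P.

Definition point s F : {poly rat} :=
  \sum_(k < size s) if F == prefix_set s k then jump s k else 0.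

Lemma mem_prefix_set s k v : v \in s -> (v \in prefix_set s k) = (index v s <= k)%N.
Proof. by move=> vs; rewrite inE in_take. Qed.

Lemma card_prefix_set s k : uniq s -> (k < size s)%N -> #|prefix_set s k| = k.+1.
Proof.
by move=> us ks; rewrite cardsE (card_uniqP (take_uniq _ us)) size_takel.
Qed.

Lemma weight_nth_neq s k : uniq s -> (k < size s)%N ->
  nth 0 (map weight s) k != nth 0 (map weight s) k.+1.
Proof.
move=> us ks; have [x0 _] : exists x0 : E, x0 \in s.
  by case: s us ks => // x s _ _; exists x; apply: mem_head.
rewrite (nth_map x0) //; have [ks1|ks1] := ltnP k.+1 (size s); last first.
  by rewrite [X in _ != X]nth_default ?size_map // /weight pnatr_eq0.
rewrite (nth_map x0) // /weight eqr_nat eqSS.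
apply/eqP => /ord_inj/enum_rank_inj/eqP; rewrite nth_uniq //.
by rewrite ltn_eqF.
Qed.

Lemma jump_neq0 s k : uniq s -> (k < size s)%N -> jump s k != 0.
Proof.
by move=> us ks; rewrite mulf_neq0 ?polyX_eq0 // polyC_eq0 subr_eq0 weight_nth_neq.
Qed.

Lemma point_prefix s k : uniq s -> (k < size s)%N -> point s (prefix_set s k) = jump s k.
Proof.
move=> us ks; rewrite /point (bigD1 (Ordinal ks)) //= eqxx big1 ?addr0 // => l lk.
case: eqP => // /(congr1 (fun F : {set E} => #|F|)); rewrite !card_prefix_set // => -[kl].
by case/eqP: lk; apply/val_inj.
Qed.

(** Agrees with the junk value of [xvar] at the empty set, so evaluation of [xvar F] needs no side
    condition on F. *)
Lemma point_set0 s : point s set0 = 0.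
Proof.
rewrite /point big1 // => k _; case: eqP => // /setP; case: s k => [[]//|x s] k /(_ x).
by rewrite mem_prefix_set ?mem_head //= eqxx inE.
Qed.

Lemma point_incomp s F G : incomparable F G -> point s F * point s G = 0.
Proof.
move=> /andP[FG GF]; rewrite /point mulr_suml big1 // => k _.
case: eqP => [Fk|_]; last by rewrite mul0r.
rewrite mulr_sumr big1 // => l _; case: eqP => [Gl|_]; last by rewrite mulr0.
have le i j : (i <= j)%N -> prefix_set s i \subset prefix_set s j.
  move=> ij; apply/subsetP => v vi.
  have vs : v \in s by move: vi; rewrite inE => /mem_take.
  by move: vi; rewrite !mem_prefix_set // => /leq_trans; apply.
case/orP: (leq_total k l) => /le.
  by rewrite -Fk -Gl (negbTE FG).
by rewrite -Fk -Gl (negbTE GF).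
Qed.

Lemma point_linear s i : uniq s -> i \in s ->
  \sum_(F : {set E} | i \in F) point s F = 'X * (weight i)%:P.
Proof.
move=> us is_; rewrite exchange_big /=.
transitivity (\sum_(k < size s) if (index i s <= k)%N then jump s k else 0).
  apply: eq_bigr => k _; rewrite -big_mkcondr /= -mem_prefix_set //.
  case: ifP => ik; last first.
    by rewrite big_pred0 // => F; case: eqP => [->|_]; rewrite ?andbF // ik.
  by rewrite (big_pred1 (prefix_set s k)) // => F /=; case: eqP => [->|_]; rewrite ?ik ?andbF.
rewrite -(big_mkord xpredT (fun k => if (index i s <= k)%N then jump s k else 0)).
rewrite (big_cat_nat (n := index i s)) ?index_size //=.
rewrite big_nat big1 ?add0r => [|k /andP[_ ki]]; last by rewrite leqNgt ki.
rewrite big_nat (eq_bigr (jump s)) => [|k /andP[->]//]; rewrite -big_nat.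
rewrite /jump -mulr_sumr -rmorph_sum /=; congr (_ * _%:P).
(* The jumps telescope from the position of i on; the boundary term past the end is the default
   0. *)
under eq_bigr do rewrite -opprB.
rewrite sumrN telescope_sumr ?opprB; last by rewrite ltnW ?index_mem.
rewrite [X in _ - X]nth_default ?size_map // subr0 (nth_map i) ?index_mem //.
by rewrite nth_index.
Qed.

Lemma eq_prefix_sets s s' : uniq s -> uniq s' -> size s = size s' ->
  (forall k, (k < size s)%N -> prefix_set s k = prefix_set s' k) -> s = s'.
Proof.
move=> us us' ss H; have Hk k : (k <= size s)%N -> take k s =i take k s'.
  case: k => [_ v|k ks v]; first by rewrite !take0.
  by move/setP/(_ v): (H k ks); rewrite !inE.
case: s us ss H Hk => [|x0 s0]; first by case: s' {us'}.
set s := x0 :: s0 => us ss H Hk; apply: (eq_from_nth (x0 := x0)) => // k ks.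
have ks' : (k < size s')%N by rewrite -ss.
have : nth x0 s k \in take k.+1 s' by rewrite -Hk // (take_nth x0) // mem_rcons mem_head.
rewrite (take_nth x0) // mem_rcons inE => /predU1P[//|].
rewrite -Hk ?(ltnW ks) // => kin.
by move: (take_uniq k.+1 us); rewrite (take_nth x0) // rcons_uniq kin.
Qed.

(** The flag monomials are nonzero multiples of the indicator functions of the points, which makes
    the matrix [diag_mx D] below diagonal and invertible over fractions. *)
Lemma point_flag t u :
  (\prod_(k < #|E|) point (word u) (prefix_set (word t) k) != 0) = (t == u).
Proof.
have [ut uu] := (word_uniq t, word_uniq u).
apply/idP/eqP => [|<-]; last first.
  apply/prodf_neq0 => k _; rewrite point_prefix ?size_word //.
  by apply: jump_neq0; rewrite ?size_word.
move/prodf_neq0 => H; apply/word_inj/eq_prefix_sets; rewrite ?size_word // => k kE.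
have := H (Ordinal kE) isT; rewrite /point /=.
have [->//|neq] := eqVneq (prefix_set (word t) k) (prefix_set (word u) k).
rewrite big1 ?eqxx // => l _; case: eqP => // e.
have lE : (l < size (word u))%N := ltn_ord l.
have := congr1 (fun F : {set E} => #|F|) e; rewrite !card_prefix_set ?size_word //.
by move=> [kl]; rewrite e kl eqxx in neq.
Qed.

Definition fam_value t u : {poly rat} :=
  \prod_(S in word_family (word t)) gsum [set: E] (point (word u)) S.

Notation R := {ffun arrangement E -> {poly rat}}.

Definition points F : R := [ffun u => point (word u) F].

Definition const_fun (x : R) : Prop := exists p : {poly rat}, x = [ffun=> p].

Lemma const_fun_subring : subring const_fun.
Proof.
split; first by exists 1.
- by move=> _ _ [p ->] [q ->]; exists (p - q); apply/ffunP => u; rewrite !ffunE.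
- by move=> _ _ [p ->] [q ->]; exists (p * q); apply/ffunP => u; rewrite !ffunE.
Qed.

Lemma points_datum :
  chow_datum [set: E] 1 points (fun i => [ffun=> 'X * (weight i)%:P]).
Proof.
split=> [F G _ _ FG|i _]; rewrite !mul1r.
  by apply/ffunP => u; rewrite !ffunE point_incomp.
apply/ffunP => u; rewrite sum_ffunE ffunE -(point_linear (word_uniq u)) ?mem_word //.
by apply: eq_big => [F|F _]; rewrite ?subsetT ?ffunE.
Qed.

Lemma prod_ffunE (I : finType) (P : pred I) (f : I -> R) u :
  (\prod_(i | P i) f i) u = \prod_(i | P i) f i u.
Proof.
by apply: (big_morph (fun x : R => x u)) => [x y|]; rewrite !ffunE.
Qed.

Lemma fam_valueE t u :
  fam_value t u = (\prod_(S in word_family (word t)) gsum [set: E] points S) u.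
Proof.
rewrite prod_ffunE; apply: eq_bigr => S _; rewrite /gsum sum_ffunE.
by apply: eq_bigr => F _; rewrite ffunE.
Qed.

Lemma normal_family_word M : normal_family [set: E] M ->
  exists t, word_family (word t) = M.
Proof.
move/word_family_surj => [s [us es fs]].
have [|t ts] := word_surj us; last by exists t; rewrite ts.
by rewrite -(card_uniqP us) -[LHS]cardsE es cardsT.
Qed.

Lemma alg_values x : alg const_fun points [set: E] x ->
  exists b : arrangement E -> {poly rat}, forall u, x u = \sum_t b t * fam_value t u.
Proof.
move=> ax; have K := const_fun_subring.
have kw i : const_fun [ffun=> 'X * (weight i)%:P] by eexists.
have := spanning (s := fun=> 0) K points_datum kw (fun=> subring0 K) ax.
rewrite (_ : (fun S => _ + 0) = gsum [set: E] points); last first.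
  by apply/funext => S; rewrite addr0.
case/(span_coef K) => b [kb]; rewrite !mul1r => xE.
(* Several words might still share a family, injectivity being deduced from independence later; one
   word per family is chosen to carry its coefficient. *)
pose rep M : option (arrangement E) := [pick t | word_family (word t) == M].
have [p bp] : exists p : {set {set E}} -> {poly rat}, forall M, b M = [ffun=> p M].
  exact: (choice (fun M p => b M = [ffun=> p]) kb).
exists (fun t => \sum_(M | normal_family [set: E] M && (rep M == Some t)) p M) => u.
under [RHS]eq_bigr do rewrite mulr_suml.
rewrite (exchange_big_dep (normal_family [set: E])) /= => [|t M _ /andP[]//].
rewrite xE sum_ffunE; apply: eq_bigr => M nM.
have [t wt] := normal_family_word nM.
case e: (rep M) => [t'|]; last first.
  by move: e; rewrite /rep; case: pickP => // /(_ t); rewrite wt eqxx.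
have wt' : word_family (word t') = M.
  by move: e; rewrite /rep; case: pickP => // t'' /eqP wt'' [<-].
rewrite (big_pred1 t') => [|t'']; last by rewrite nM /= (inj_eq (@Some_inj _)) eq_sym.
by rewrite fam_valueE wt' bp !ffunE.
Qed.

Lemma fam_value_free (b : arrangement E -> {poly rat}) :
  (forall u, \sum_t b t * fam_value t u = 0) -> forall t, b t = 0.
Proof.
pose N := #|{: arrangement E}|; pose v (i : 'I_N) : arrangement E := enum_val i.
pose G : 'M[{poly rat}]_N := \matrix_(i, j) fam_value (v i) (v j).
have [A eA] : exists A : arrangement E -> arrangement E -> {poly rat}, forall w u,
    (\prod_(k < #|E|) points (prefix_set (word w) k)) u = \sum_t A w t * fam_value t u.
  apply: (choice (fun w (a : arrangement E -> {poly rat}) => forall u,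
    (\prod_(k < #|E|) points (prefix_set (word w) k)) u = \sum_t a t * fam_value t u)) => w.
  apply: alg_values; elim/big_ind: _ => [|x y|k _].
  - by apply: alg_const; case: const_fun_subring.
  - exact: alg_mul.
  - apply: alg_gen; last exact: subsetT.
    by rewrite -card_gt0 card_prefix_set ?size_word ?word_uniq.
pose D : 'rV[{poly rat}]_N :=
  \row_i \prod_(k < #|E|) point (word (v i)) (prefix_set (word (v i)) k).
have AG : (\matrix_(i, j) A (v i) (v j)) *m G = diag_mx D.
  apply/matrixP => i j; rewrite !mxE.
  transitivity (\sum_t A (v i) t * fam_value t (v j)).
    rewrite (reindex v) /=; last exact: onW_bij (enum_val_bij _).
    by apply: eq_bigr => l _; rewrite !mxE.
  rewrite -eA prod_ffunE; have [->|ij] := eqVneq i j.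
    by rewrite mulr1n; apply: eq_bigr => k _; rewrite ffunE.
  rewrite mulr0n; apply/eqP; rewrite -[_ == 0]negbK.
  under eq_bigr do rewrite ffunE.
  by rewrite point_flag (inj_eq enum_val_inj).
have detG : \det G != 0.
  have : \det (diag_mx D) != 0.
    by rewrite det_diag; apply/prodf_neq0 => i _; rewrite mxE point_flag.
  by rewrite -AG det_mulmx mulf_eq0 negb_or => /andP[].
move=> H t; pose B : 'rV[{poly rat}]_N := \row_i b (v i).
have BG : B *m G = 0.
  apply/matrixP => i j; rewrite !mxE -[RHS](H (v j)) [RHS](reindex v) /=.
    by apply: eq_bigr => l _; rewrite !mxE.
  exact: onW_bij (enum_val_bij _).
(* Over the domain [{poly rat}] the adjugate stands in for an inverse of G. *)
have : B *m (G *m \adj G) = 0 by rewrite mulmxA BG mul0mx.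
rewrite mul_mx_adj mul_mx_scalar => /matrixP/(_ 0 (enum_rank t)).
rewrite !mxE => /eqP; rewrite mulf_eq0 (negbTE detG) /= => /eqP.
by rewrite /v enum_rankK.
Qed.

(** If t and u shared a family, the difference of their coordinate vectors would be a nontrivial
    relation among the values. *)
Lemma word_family_inj : injective (fun t => word_family (word t)).
Proof.
move=> t u tu; apply/eqP; apply: contraT => ntu.
have /(_ _ t) := @fam_value_free (fun w => (w == t)%:R - (w == u)%:R).
rewrite eqxx (negbTE ntu) subr0 => H.
suff /eqP : (1 : {poly rat}) = 0 by rewrite oner_eq0.
apply: H => w.
under eq_bigr do rewrite mulrBl.
rewrite sumrB (bigD1 t) //= eqxx mul1r big1 ?addr0 => [|x /negbTE->]; last by rewrite mul0r.
rewrite (bigD1 u) //= eqxx mul1r big1 ?addr0 => [|x /negbTE->]; last by rewrite mul0r.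
by rewrite /fam_value tu subrr.
Qed.

End Points.

(** * Comparison with the monomials and permutations of the statement *)

Section Bridge.
Context {d : Order.disp_t} {E : finOrderType d}.
Implicit Types (I J F G S T : {set E}) (M : {set {set E}}) (m : hmonomial E).
Implicit Types (t u : arrangement E).

Lemma is_maxP F i : reflect (i \in F /\ {in F, forall v, (v <= i)%O}) (is_max F i).
Proof.
by apply: (iffP andP) => -[iF H]; split=> //; [apply/forall_inP|apply/forall_inP].
Qed.

Lemma is_max_eq F i j : is_max F i -> is_max F j -> i = j.
Proof.
move=> /is_maxP[iF Hi] /is_maxP[jF Hj]; apply: le_anti.
by rewrite Hi ?Hj.
Qed.

Lemma initial_segmentP I J (m : E) : is_max I m ->
  reflect (I \subset J /\ {in J, forall v, (v <= m)%O -> v \in I}) (initial_segment I J).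
Proof.
move=> mI; have /is_maxP[mI' Im] := mI.
have below v : [exists j, is_max I j && (v <= j)%O] = (v <= m)%O.
  apply/existsP/idP => [[j /andP[/(is_max_eq mI)<-]]//|vm].
  by exists m; rewrite mI.
apply: (iffP and3P) => [[_ IJ /eqP IE]|[IJ H]].
  by split=> // v vJ vm; rewrite IE !inE vJ below.
split=> //; first by apply/set0Pn; exists m.
apply/eqP/setP => v; rewrite !inE below; apply/idP/andP => [vI|[]]; last exact: H.
by rewrite (subsetP IJ) // Im.
Qed.

Lemma normal_pairE S T : (2 <= #|S|)%N -> (2 <= #|T|)%N ->
  normal_pair S T = npair S T.
Proof.
move=> S2 T2; rewrite /normal_pair S2 T2 /=.
have [|m mS Sm] := @set_max _ _ S; first by rewrite -card_gt0; apply: leq_trans S2.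
have mI : is_max S m by apply/is_maxP.
rewrite setDUl setDv setU0.
have third : m \notin T ->
    (2 <= #|S :\: T|)%N || (T == [set i in S :|: T | ~~ is_max (S :|: T) i]) ->
    {in T, forall v, (v <= m)%O -> v \in S} ->
    T \subset S \/ exists w, [/\ w \in S, w \notin T & w != m].
  move=> mT /orP[ST2|/eqP TE] Tm; [right|left].
    have /card_gt0P[w] : (0 < #|(S :\: T) :\ m|)%N.
      by move: ST2; rewrite (cardsD1 m) inE mT mS.
    by rewrite !inE => /and3P[wm wT wS]; exists w.
  have : ~~ (m \in [set i in S :|: T | ~~ is_max (S :|: T) i]) by rewrite -TE.
  rewrite !inE mS /= negbK => /is_maxP[_ Um].
  by apply/subsetP => v vT; apply: Tm => //; apply: Um; rewrite inE vT orbT.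
apply/and3P/npairP => [[/(initial_segmentP _ mI)[SU Um] /forallP Hmin H3]|].
  have Tm : {in T, forall v, (v <= m)%O -> v \in S}.
    by move=> v vT; apply: Um; rewrite inE vT orbT.
  have mT : m \notin T.
    (* If m were in T, [S :\ m] would be a smaller initial segment with the same union. *)
    apply/negP => mT; have [|m' m'S Sm'] := @set_max _ _ (S :\ m).
      by rewrite -card_gt0; move: S2; rewrite (cardsD1 m) mS.
    have mI' : is_max (S :\ m) m' by apply/is_maxP.
    have := Hmin (S :\ m); rewrite (_ : _ :|: T == _) ?andbT; last first.
      apply/eqP/setP => v; rewrite !inE; case: eqVneq => //= ->.
      by rewrite mT orbT.
    have -> : initial_segment (S :\ m) (S :|: T).
      apply/(initial_segmentP _ mI'); split.
        by apply: subset_trans (subsetDl _ _) (subsetUl _ _).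
      move: m'S; rewrite !inE => /andP[m'm m'S] v vU vm'.
      have m'_m := Sm m' m'S.
      rewrite !inE Um ?(le_trans vm') // andbT.
      by apply: contraNneq m'm => vm; apply/eqP/le_anti; rewrite m'_m -vm.
    by move/subsetP/(_ m mS); rewrite !inE eqxx.
  by exists m; split=> //; apply: third.
move=> [m' [m'S m'T Sm' Tm H]].
have em : m' = m by apply: le_anti; rewrite Sm ?Sm'.
subst m'; split.
- apply/(initial_segmentP _ mI); split; first exact: subsetUl.
  by move=> v; rewrite inE => /orP[//|]; apply: Tm.
- apply/forallP => I; apply/implyP => /andP[II /eqP IU].
  have mII : m \in I.
    have : m \in I :|: T by rewrite IU inE mS.
    by rewrite inE (negbTE m'T) orbF.
  have [|n nI In] := @set_max _ _ I; first by apply/set0Pn; exists m.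
  have /(initial_segmentP _ (introT (is_maxP _ _) (conj nI In)))[_ Hn] := II.
  by apply/subsetP => v vS; apply: Hn; rewrite ?inE ?vS // (le_trans (Sm v vS)) // In.
(* Otherwise m is the only element of S outside T, so T lies in S and m is the maximum of the
   union. *)
have [//|ST1] := leqP 2 #|S :\: T|; apply/eqP/setP => v.
have uniqm w : w \in S -> w \notin T -> w = m.
  move=> wS wT; apply/eqP; apply: contraLR ST1 => wm; rewrite -leqNgt.
  by rewrite (cardsD1 m) (cardsD1 w) !inE wm wT wS m'T mS.
case: H => [TS|[w [wS wT]]]; last by rewrite (uniqm w) ?eqxx.
have mU : is_max (S :|: T) m.
  apply/is_maxP; split; first by rewrite inE mS.
  by move=> w; rewrite (setUidPl TS); apply: Sm.
rewrite !inE; apply/idP/andP => [vT|[vU vmax]].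
  rewrite vT orbT; split=> //; apply/negP => /(is_max_eq mU) mv.
  by rewrite mv vT in m'T.
case/orP: vU => // vS; apply: contraT => vT.
by rewrite (uniqm v) ?mU in vmax.
Qed.

Definition hfam M : hmonomial E := (\sum_(S in M) hmon S)%MM.

Lemma hmonE S i : hmon S i = (val (enum_val i : hidx E) == S).
Proof.
rewrite /hmon; case: insubP => [v S2 <-|S2]; last first.
  rewrite mnm0E; case: eqP => // e; by rewrite -e (valP (enum_val i)) in S2.
rewrite mnm1E (inj_eq val_inj); congr nat_of_bool.
by apply/eqP/eqP => [<-|<-]; rewrite ?enum_rankK ?enum_valK.
Qed.

Lemma hfamE M i : hfam M i = (val (enum_val i : hidx E) \in M).
Proof.
rewrite mnm_sumE; under eq_bigr do rewrite hmonE.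
case: (boolP (_ \in M)) => iM; last first.
  by rewrite big1 // => S SM; case: eqP => // e; rewrite e SM in iM.
rewrite (bigD1 _ iM) eqxx /= big1 // => S /andP[_ /negbTE].
by rewrite eq_sym => ->.
Qed.

Lemma hidx_of S : (2 <= #|S|)%N -> exists i : 'I_#|{: hidx E}|, val (enum_val i : hidx E) = S.
Proof. by move=> S2; exists (enum_rank (exist _ S S2 : hidx E)); rewrite enum_rankK. Qed.

Lemma hfam_inj M N : normal_family [set: E] M -> normal_family [set: E] N ->
  hfam M = hfam N -> M = N.
Proof.
move=> /normal_familyP[M2 _] /normal_familyP[N2 _] MN; apply/setP => S.
have [S2|S1] := leqP 2 #|S|.
  have [i <-] := hidx_of S2; have := congr1 (fun m : hmonomial E => m i) MN.
  by rewrite !hfamE; do 2!case: (_ \in _).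
by apply/idP/idP => [/M2|/N2] [_]; rewrite leqNgt S1.
Qed.

Lemma normalP m : reflect (exists2 M, normal_family [set: E] M & m = hfam M) (normal m).
Proof.
apply: (iffP idP) => [nm|[M /normal_familyP[M2 Mn] ->]]; last first.
  apply/forallP => S; apply/forallP => T; apply/implyP => /mnm_lepP le.
  have := le (enum_rank S); have := le (enum_rank T).
  rewrite !mnmDE !hmonE !hfamE !enum_rankK !eqxx => HT HS.
  rewrite !normal_pairE ?(valP S) ?(valP T) //; apply: Mn.
  - by case: (_ \in M) HS.
  - by case: (_ \in M) HT => //; rewrite addn1.
  by apply: contraTneq HS => ->; rewrite eqxx; case: (_ \in M).
have pairP S T : (2 <= #|S|)%N -> (2 <= #|T|)%N -> (hmon S + hmon T <= m)%MM ->
    npair S T || npair T S.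
  move=> S2 T2; have /forallP/(_ (exist _ S S2 : hidx E))/forallP := nm.
  by move=> /(_ (exist _ T T2 : hidx E))/implyP /= H /H; rewrite !normal_pairE.
have m1 i : (m i <= 1)%N.
  rewrite leqNgt; apply/negP => mi; set S := val (enum_val i : hidx E).
  have S2 : (2 <= #|S|)%N := valP (enum_val i).
  have le : (hmon S + hmon S <= m)%MM.
    apply/mnm_lepP => j; rewrite mnmDE !hmonE /S (inj_eq val_inj) (inj_eq enum_val_inj).
    by case: eqVneq => [->|].
  by have := pairP S S S2 S2 le; rewrite orbb => /npairP[w [wS]]; rewrite wS.
pose M := [set val (enum_val i : hidx E) | i in [pred i | m i != 0%N]].
have MP i : (val (enum_val i : hidx E) \in M) = (m i != 0%N).
  apply/imsetP/idP => [[j mj /val_inj/enum_val_inj ->]//|mi].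
  by exists i.
exists M; last first.
  by apply/mnmP => i; rewrite hfamE MP; move: (m1 i); case: (m i) => [|[]].
apply/normal_familyP; split=> [_ /imsetP[i _ ->]|_ _ /imsetP[i mi ->] /imsetP[j mj ->] ij].
  by split; [apply: subsetT | apply: (valP (enum_val i))].
apply: pairP; [exact: valP (enum_val i : hidx E) | exact: valP (enum_val j : hidx E) |].
apply/mnm_lepP => k; rewrite mnmDE !hmonE !(inj_eq val_inj) !(inj_eq enum_val_inj).
rewrite !inE in mi mj.
have [->|ki] := eqVneq k i; last by case: eqVneq => // ->; rewrite lt0n.
have [eij|_] := eqVneq i j; first by rewrite eij eqxx in ij.
by rewrite addn0 lt0n.
Qed.

End Bridge.

(** * Psi and Lehmer's code in terms of words *)

Section PsiLehmer.
Context {d : Order.disp_t} {E : finOrderType d}.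
Implicit Types (S : {set E}) (s p : seq E) (t u : arrangement E).

Lemma word_familyP x0 s S : reflect
  (exists k, [/\ (k.+1 < size s)%N, (nth x0 s k.+1 < nth x0 s k)%O &
     S = [set v in drop k s | (v <= nth x0 s k)%O]]) (S \in word_family s).
Proof.
elim: s => [|x [|y s] IH]; try by rewrite inE; constructor => -[k []].
rewrite word_family_cons; case: ifP => yx.
  apply: (iffP setU1P) => [[->|/IH[k [ks lt ->]]]|[[|k] [ks lt eS]]].
  - by exists 0%N.
  - by exists k.+1.
  - by left.
  - by right; apply/IH; exists k.
apply: (iffP IH) => [[k [ks lt ->]]|[[|k] [ks lt eS]]]; first by exists k.+1.
  by rewrite /= yx in lt.
by exists k.
Qed.

Lemma desc_setE t (i : 'I_#|E|) : desc_set t i =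
  [set v in drop i (word t) | (v <= nth (val t i) (word t) i)%O].
Proof.
apply/setP => v; rewrite inE nth_word; apply/imsetP/andP => [[j]|[vd vi]].
  rewrite inE => /andP[ij ji] ->; split=> //.
  rewrite -(nth_word t j (val t i)) -{1}(subnKC ij) -nth_drop mem_nth //.
  by rewrite size_drop size_word ltn_sub2r ?(leq_ltn_trans ij).
have vw := mem_drop vd; have kE : (index v (word t) < #|E|)%N by rewrite -(size_word t) index_mem.
have tv : val t (Ordinal kE) = v by rewrite -(nth_word t (Ordinal kE) v) nth_index.
exists (Ordinal kE) => //; rewrite inE tv vi andbT /= leqNgt -in_take //.
apply/negP => vt; have := word_uniq t; rewrite -(cat_take_drop i (word t)) cat_uniq.
by case/and3P => _ /hasP[]; exists v.
Qed.

Lemma Psi_word t : Psi t = hfam (word_family (word t)).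
Proof.
have -> : word_family (word t) = desc_set t @: descents t.
  case: (posnP #|E|) => [E0|E0].
    have w0 : word t = [::] by apply/size0nil; rewrite size_word.
    rewrite w0; apply/setP => S; rewrite inE; apply/esym/imsetP => -[i].
    by have := ltn_ord i; rewrite {2}E0.
  pose x0 := val t (Ordinal E0).
  apply/setP => S; apply/(word_familyP x0)/imsetP => [[k [ks lt ->]]|[i]].
    rewrite size_word in ks; have ks' := ltnW ks.
    exists (Ordinal ks').
      rewrite inE; apply/existsP; exists (Ordinal ks); rewrite eqxx /=.
      by rewrite -(nth_word t (Ordinal ks) x0) -(nth_word t (Ordinal ks') x0).
    by rewrite desc_setE /= (set_nth_default x0) ?size_word.
  rewrite inE => /existsP[j /andP[/eqP ji lt]] ->; exists i.
  rewrite size_word -ji ltn_ord !nth_word; split=> //.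
  by rewrite desc_setE nth_word.
(* The maximum of a descent set is the letter at its descent, so distinct descents give distinct
   sets. *)
rewrite /hfam big_imset //= => i j _ _ /setP eq_ij.
have top k : is_max (desc_set t k) (val t k).
  apply/is_maxP; split; first by apply/imsetP; exists k; rewrite // inE leqnn lexx.
  by move=> v /imsetP[l]; rewrite inE => /andP[_ ?] ->.
have inj : injective (val t) by apply/injectiveP; case: (t).
by apply: inj; apply: (is_max_eq (top i)); move/setP: eq_ij => ->; apply: top.
Qed.

Lemma nth_code_aux x0 p s i : (i < size s)%N ->
  nth 0%N (code_aux p s) i = count (fun y => nth x0 s i < y)%O (p ++ take i s).
Proof.
elim: s p i => // x s IH p [|i] /=; first by rewrite cats0.
by rewrite ltnS => /IH->; rewrite !count_cat /= addnCA addnA.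
Qed.

Lemma lehmer_word t : lehmer t = code (word t).
Proof.
apply: (eq_from_nth (x0 := 0%N)); first by rewrite size_code_aux size_word size_codom card_ord.
rewrite size_codom card_ord => i iE; pose k := Ordinal iE.
rewrite (nth_code_aux (val t k)) ?size_word // cat0s.
rewrite [LHS](_ : _ = #|[set j : 'I_#|E| | (j < k)%N && (val t k < val t j)%O]|); last first.
  by rewrite /lehmer /image_mem (nth_map k) ?size_enum_ord // (nth_ord_enum k k).
have inj : injective (val t) by apply/injectiveP; case: (t).
rewrite -(card_imset _ inj) -size_filter -(card_uniqP _); last first.
  by rewrite filter_uniq ?take_uniq ?word_uniq.
apply: eq_card => v; rewrite mem_filter (nth_word t k); apply/imsetP/andP => [[j]|[kv vt]].
  rewrite inE => /andP[jk kj] ->; split=> //; rewrite in_take ?mem_word //.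
  by rewrite -(nth_word t j (val t k)) index_uniq ?word_uniq ?size_word.
have kE : (index v (word t) < #|E|)%N by rewrite -(size_word t) index_mem mem_word.
have tv : val t (Ordinal kE) = v by rewrite -(nth_word t (Ordinal kE) v) nth_index ?mem_word.
exists (Ordinal kE); rewrite ?tv // inE tv kv andbT /=.
by rewrite -in_take ?mem_word.
Qed.

Lemma Psi_normal t : normal (Psi t).
Proof.
apply/normalP; exists (word_family (word t)); last exact: Psi_word.
exact: normal_familyS (subsetT _) (word_family_normal (word_uniq t)).
Qed.

Lemma Psi_surj (m : hmonomial E) : normal m -> exists t, m = Psi t.
Proof.
case/normalP => M nM ->; have [t <-] := normal_family_word nM.
by exists t; rewrite Psi_word.
Qed.

Lemma Psi_inj : injective (@Psi _ E).
Proof.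
move=> t u; rewrite !Psi_word => /hfam_inj H; apply: word_family_inj; apply: H;
  exact: normal_familyS (subsetT _) (word_family_normal (word_uniq _)).
Qed.

Lemma lehmer_invseq t : invseq (lehmer t) /\ size (lehmer t) = #|E|.
Proof. by rewrite lehmer_word; split; [apply: invseq_code|rewrite size_code_aux size_word]. Qed.

Lemma lehmer_surj e : invseq e -> size e = #|E| -> exists t, lehmer t = e.
Proof.
move=> inv es; have [|s [us sE cs]] := @code_surj _ E [set: E] _ inv; first by rewrite cardsT.
have [|t ts] := word_surj us; last by exists t; rewrite lehmer_word ts.
by rewrite -(size_code_aux [::] s) -/(code s) cs.
Qed.

End PsiLehmer.

(** * Independence of normal monomials in the Chow ring *)

Section ChowRelations.
Local Open Scope ring_scope.
Local Open Scope quotient_scope.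
Context {d : Order.disp_t} {E : finOrderType d}.
Implicit Types (F G S : {set E}) (t u : arrangement E).

Lemma chow_class_eq0 (p : xpoly E) : chow_class p = 0 <-> in_chow_ideal p.
Proof.
rewrite -(rmorph0 (@chow_class E)); split.
  move=> /eqP H; apply/asboolP; rewrite -[p]subr0.
  by have := Quotient.idealrBE (@chow_ideal E) p 0; rewrite H.
move=> H; apply/eqP; rewrite -(Quotient.idealrBE (@chow_ideal E)) subr0.
exact/asboolP.
Qed.

Lemma chow_linear (i : E) : chow_class (\sum_(F : {set E} | i \in F) xvar F) = 0.
Proof.
apply/chow_class_eq0; exists (fun j => (j == i)%:R), (fun _ _ => 0).
rewrite [X in _ = _ + X]big1 ?addr0 => [|F _]; last by rewrite big1 // => G _; rewrite mul0r.
rewrite (bigD1 i) //= eqxx mul1r [X in _ + X]big1 ?addr0 // => j /negbTE->.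
by rewrite mul0r.
Qed.

Lemma chow_incomp F G : incomparable F G -> chow_class (xvar F * xvar G) = 0.
Proof.
move=> FG; have /andP[/subsetPn[v vF _] /subsetPn[w wG _]] := FG.
have F0 : F != set0 by apply/set0Pn; exists v.
have G0 : G != set0 by apply/set0Pn; exists w.
apply/chow_class_eq0; exists (fun=> 0), (fun F' G' => ((F' == F) && (G' == G))%:R).
rewrite big1 ?add0r => [|j _]; last by rewrite mul0r.
rewrite (bigD1 F) //= (bigD1 G) ?G0 //= !eqxx mul1r [X in _ + X + _]big1 ?addr0; last first.
  by move=> G' /andP[_ /negbTE->]; rewrite mul0r.
rewrite big1 ?addr0 // => F' /andP[_ /negbTE F'F]; rewrite big1 // => G' _.
by rewrite F'F mul0r.
Qed.

Lemma chow_datum_chow :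
  chow_datum [set: E] 1 (fun F => chow_class (xvar F)) (fun=> 0 : chow E).
Proof.
split=> [F G _ _ FG|i _]; rewrite !mul1r; first by rewrite -(chow_incomp FG) (rmorphM (@chow_class E)).
apply: etrans (chow_linear i); rewrite (rmorph_sum (@chow_class E)).
by apply: eq_bigl => F; rewrite subsetT.
Qed.

Lemma above_maxP F v : F != set0 ->
  (v \in above_max F) = [forall u in F, (u < v)%O].
Proof.
case/set_max => m mF Fm; have mM : is_max F m by apply/is_maxP.
rewrite inE; apply/existsP/forall_inP => [[j /andP[jM jv]] u uF|H].
  by rewrite -(is_max_eq mM jM) in jv; apply: le_lt_trans jv; apply: Fm.
by exists m; rewrite mM H.
Qed.

Lemma gsum_above (R : comPzRingType) (y : {set E} -> R) F : F != set0 ->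
  \sum_(S : {set E} | S \subset above_max F) y (F :|: S) = gsum [set: E] y F.
Proof.
move=> F0; rewrite /gsum [RHS](reindex_onto (fun S => F :|: S) (fun G => G :\: F)) /=; last first.
  by move=> G /upperP[FG _ _]; rewrite -{1}(setIidPr FG) setID.
apply: eq_bigl => S; rewrite setDUl setDv set0U; apply/idP/andP => [SF|].
  have dS : S :\: F = S.
    apply/setDidPl; rewrite -setI_eq0; apply/eqP/setP => v; rewrite !inE.
    apply/negbTE/andP => -[/(subsetP SF)]; rewrite above_maxP // => /forall_inP H vF.
    by have := H v vF; rewrite ltxx.
  split; last by rewrite dS.
  apply/upperP; split; rewrite ?subsetUl ?subsetT // => v u; rewrite inE => /orP[->//|vS] _ uF.
  by have := subsetP SF v vS; rewrite above_maxP // => /forall_inP; apply.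
case=> /upperP[_ _ H] /eqP dS; apply/subsetP => v vS; rewrite above_maxP //.
by apply/forall_inP => u uF; apply: H => //; [rewrite inE vS orbT | move: vS; rewrite -dS inE => /andP[]].
Qed.

Lemma chow_gE F : F != set0 ->
  chow_g F = gsum [set: E] (fun G => chow_class (xvar G)) F.
Proof. by move=> F0; rewrite -gsum_above // /chow_g rmorph_sum. Qed.

Lemma g_evalB (p q : hpoly E) : g_eval (p - q) = g_eval p - g_eval q.
Proof. exact: rmorphB. Qed.

Lemma g_evalZ c (p : hpoly E) : g_eval (c *: p) = chow_class c%:MP * g_eval p.
Proof. exact: mmapZ. Qed.

Lemma g_eval_sum I (r : seq I) (P : pred I) (p : I -> hpoly E) :
  g_eval (\sum_(i <- r | P i) p i) = \sum_(i <- r | P i) g_eval (p i).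
Proof. exact: rmorph_sum. Qed.

Lemma g_eval_hmon S : (2 <= #|S|)%N -> g_eval 'X_[hmon S] = chow_g S.
Proof.
by move=> S2; rewrite /g_eval mmapX /hmon insubT mmap1U enum_rankK.
Qed.

Lemma g_eval_Psi t : g_eval 'X_[Psi t] =
  \prod_(S in word_family (word t)) gsum [set: E] (fun G => chow_class (xvar G)) S.
Proof.
rewrite Psi_word /hfam -mprodXE /g_eval rmorph_prod; apply: eq_bigr => S SM.
have /normal_familyP[/(_ S SM)[_ S2] _] := word_family_normal (word_uniq t).
rewrite -chow_gE; last by rewrite -card_gt0; apply: leq_trans S2.
exact: g_eval_hmon.
Qed.

(** This does not factor through the Chow ring: it kills products of incomparable variables, but
    sends the linear form of i to ['X * (weight i)%:P]. *)
Definition eval_point u : xpoly E -> {poly rat} :=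
  mmap (@polyC rat) (fun i => point (word u) (val (enum_val i : xidx E))).

Lemma eval_pointD u (p q : xpoly E) : eval_point u (p + q) = eval_point u p + eval_point u q.
Proof. exact: rmorphD. Qed.

Lemma eval_pointM u (p q : xpoly E) : eval_point u (p * q) = eval_point u p * eval_point u q.
Proof. exact: rmorphM. Qed.

Lemma eval_point_sum u I (r : seq I) (P : pred I) (p : I -> xpoly E) :
  eval_point u (\sum_(i <- r | P i) p i) = \sum_(i <- r | P i) eval_point u (p i).
Proof. exact: rmorph_sum. Qed.

Lemma eval_point_prod u I (r : seq I) (P : pred I) (p : I -> xpoly E) :
  eval_point u (\prod_(i <- r | P i) p i) = \prod_(i <- r | P i) eval_point u (p i).
Proof. exact: rmorph_prod. Qed.

Lemma eval_pointC u c : eval_point u c%:MP = c%:P.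
Proof. exact: mmapC. Qed.

Lemma eval_point_monomial u (m : 'X_{1..#|{: xidx E}|}) : eval_point u 'X_[m] =
  \prod_i point (word u) (val (enum_val i : xidx E)) ^+ m i.
Proof. exact: mmapX. Qed.

Lemma eval_point_xvar u F : eval_point u (xvar F) = point (word u) F.
Proof.
rewrite /xvar; case: insubP => [v _ <-|].
  by rewrite /eval_point mmapX mmap1U enum_rankK.
by rewrite negbK => /eqP->; rewrite -mpolyC0 eval_pointC point_set0.
Qed.

(** Lets [alg_values] expand the coefficients that witness membership in the ideal. *)
Lemma eval_point_alg (p : xpoly E) :
  alg (@const_fun _ E) points [set: E] [ffun u => eval_point u p].
Proof.
elim/mpolyind: p => [|c m p _ _ IH].
  have -> : [ffun u => eval_point u 0] = 0 :> {ffun arrangement E -> {poly rat}}.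
    by apply/ffunP => u; rewrite !ffunE -mpolyC0 eval_pointC.
  by apply/alg_const/(subring0 const_fun_subring).
have -> : [ffun u => eval_point u (c *: 'X_[m] + p)] =
  [ffun=> c%:P] * (\prod_i points (val (enum_val i : xidx E)) ^+ m i) +
  [ffun u => eval_point u p] :> {ffun arrangement E -> {poly rat}}.
  apply/ffunP => u; rewrite !ffunE eval_pointD -mul_mpolyC eval_pointM eval_pointC.
  rewrite eval_point_monomial prod_ffunE.
  congr (_ * _ + _); apply: eq_bigr => i _; elim: (m i) => [|k IHk].
    by rewrite !expr0 ffunE.
  by rewrite !exprS ffunE -IHk ffunE.
apply: alg_add => //; apply: alg_mul; first by apply: alg_const; exists c%:P.
have K := alg_subring points [set: E] (@const_fun_subring _ E).
elim/big_ind: _ => [|x y|i _]; [by case: K|exact: alg_mul|].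
elim: (m i) => [|k IHk]; first by case: K.
rewrite exprS; apply: alg_mul => //; apply: alg_gen (subsetT _).
exact: valP (enum_val i : xidx E).
Qed.

(* In the deformed ring the relation holds up to a multiple of 'X, whose coordinates on the
   normal monomials are again multiples of 'X: so each r t vanishes at 0. *)
Lemma Psi_free (r : arrangement E -> rat) :
  g_eval (\sum_t r t *: 'X_[Psi t]) = 0 -> forall t, r t = 0.
Proof.
pose P := \sum_t (r t)%:MP * \prod_(S in word_family (word t)) gsum [set: E] (@xvar E) S.
have -> : g_eval (\sum_t r t *: 'X_[Psi t]) = chow_class P.
  rewrite g_eval_sum (rmorph_sum (@chow_class E)); apply: eq_bigr => t _.
  rewrite g_evalZ rmorphM; congr (_ * _); rewrite g_eval_Psi rmorph_prod.
  by apply: eq_bigr => S _; rewrite rmorph_sum.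
case/chow_class_eq0 => a [b PE] t.
have evP u : \sum_t (r t)%:P * fam_value t u = 'X * \sum_i eval_point u (a i) * (weight i)%:P.
  transitivity (eval_point u P).
    rewrite eval_point_sum; apply: eq_bigr => w _; rewrite eval_pointM eval_point_prod.
    rewrite eval_pointC; congr (_ * _); apply: eq_bigr => S _.
    by rewrite eval_point_sum; apply: eq_bigr => F _; rewrite eval_point_xvar.
  rewrite PE eval_pointD !eval_point_sum [X in _ + X]big1 ?addr0 => [|F F0].
    rewrite mulr_sumr; apply: eq_bigr => i _; rewrite eval_pointM eval_point_sum.
    under eq_bigr do rewrite eval_point_xvar.
    by rewrite (point_linear (word_uniq u)) ?mem_word // mulrCA.
  rewrite eval_point_sum big1 // => G /andP[G0 FG]; rewrite !eval_pointM !eval_point_xvar.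
  by rewrite point_incomp ?mulr0.
have [B eB] : exists B : E -> arrangement E -> {poly rat}, forall i u,
    eval_point u (a i) = \sum_t B i t * fam_value t u.
  apply: (choice (fun i (B : arrangement E -> {poly rat}) => forall u,
    eval_point u (a i) = \sum_t B t * fam_value t u)) => i.
  have [B eB] := alg_values (eval_point_alg (a i)); exists B => u.
  by rewrite -eB ffunE.
suff /(_ t)/eqP : forall t, (r t)%:P - 'X * \sum_i B i t * (weight i)%:P = 0.
  rewrite subr_eq0 => /eqP/(congr1 (fun p : {poly rat} => p.[0])).
  by rewrite hornerM hornerX mul0r hornerC.
apply: fam_value_free => u.
under eq_bigr do rewrite mulrBl; rewrite sumrB evP.
under [X in _ * X - _]eq_bigr do rewrite eB mulr_suml.
rewrite exchange_big /= mulr_sumr -sumrB big1 // => w _.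
rewrite -mulrA -mulrBr mulr_suml -sumrB big1 ?mulr0 // => i _.
by rewrite mulrAC subrr.
Qed.

Lemma normal_free (p : hpoly E) : all normal (msupp p) -> g_eval p = 0 -> p = 0.
Proof.
move=> np; have pE : p = \sum_t p@_(Psi t) *: 'X_[Psi t].
  apply/mpolyP => m; rewrite raddf_sum /=.
  under eq_bigr do rewrite mcoeffZ mcoeffX.
  have [nm|nm] := boolP (normal m); last first.
    rewrite memN_msupp_eq0 ?big1 // => [t _|]; last by apply: contra nm; apply: (allP np).
    by case: eqP nm => [<-|_ _]; rewrite ?mulr0 // Psi_normal.
  have [t ->] := Psi_surj nm; rewrite (bigD1 t) //= eqxx mulr1 big1 ?addr0 // => u ut.
  by rewrite (inj_eq Psi_inj) (negbTE ut) mulr0.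
rewrite {1}pE => /Psi_free r0; rewrite pE big1 // => t _.
by rewrite r0 scale0r.
Qed.

Lemma is_rewriting_uniq (x : chow E) r r' : is_rewriting x r -> is_rewriting x r' -> r = r'.
Proof.
move=> [n1 e1] [n2 e2]; apply/eqP; rewrite -subr_eq0; apply/eqP/normal_free.
  apply/allP => m /msuppB_le; rewrite mem_cat => /orP[]; [exact: (allP n1)|exact: (allP n2)].
by rewrite g_evalB e1 e2 subrr.
Qed.

Lemma rewriting_eq (x : chow E) r : is_rewriting x r -> rewriting x = r.
Proof.
move=> xr; apply: is_rewriting_uniq (xr).
by apply: epsilon_spec; exists r.
Qed.

End ChowRelations.

(** * Rewriting of products with g_E, and the recursion for g_n *)

Section Rewriting.
Local Open Scope ring_scope.
Context {d : Order.disp_t} {E : finOrderType d}.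
Implicit Types (t u : arrangement E).

Lemma rewriting_mul_top t r : step (lehmer t) r ->
  if r is Some e' then exists2 u, lehmer u = e' &
    is_rewriting (chow_g [set: E] * g_eval 'X_[Psi t]) 'X_[Psi u]
  else is_rewriting (chow_g [set: E] * g_eval 'X_[Psi t]) 0.
Proof.
move=> st; have wT : [set v in word t] = [set: E].
  by apply/setP => v; rewrite !inE mem_word.
have E0 : [set: E] != set0.
  rewrite -card_gt0 cardsT -(size_word t); rewrite lehmer_word in st.
  rewrite -(size_code_aux [::] (word t)) -/(code _).
  by elim: st => //= *; rewrite ?size_rcons ?size_cat ?addnS.
have gT : chow_g [set: E] = chow_class (xvar [set: E]) by rewrite chow_gE // gsum_top.
have := mul_top st (word_uniq t) wT (esym (lehmer_word t)) chow_datum_chow.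
rewrite -gT [fprod _ _ (word t)](esym (g_eval_Psi t)).
case: r {st} => [e' [s' [pe ce]]|]; rewrite !mul1r => H; last first.
  by split; rewrite ?msupp0 // H -(subrr 0) g_evalB subrr.
have [||u us] := @word_surj _ _ s'.
- by rewrite (perm_uniq pe) word_uniq.
- by rewrite (perm_size pe) size_word.
exists u; first by rewrite lehmer_word us.
by split; [rewrite msuppX /= Psi_normal | rewrite H g_eval_Psi us].
Qed.

Lemma is_invseqP n e : is_invseq n e <-> size e = n /\ invseq e.
Proof.
split=> -[es inv]; split=> // i.
  have [ie|ie] := ltnP i n; last by rewrite nth_default ?es.
  by have := inv i.+1; rewrite /entry subn1; apply.
by case: i => // i _; rewrite subn1; apply: inv.
Qed.

(** The product is computed from the code alone, so any preimage found by the first search will do;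
    in the second search, injectivity of [Psi] leaves a single candidate. *)
Lemma g_map_step e r : is_invseq #|E| e -> step e r -> g_map E e = r.
Proof.
move=> /is_invseqP[es inv] st; rewrite /g_map.
case: pickP => [t /eqP et|H]; last first.
  by have [t et] := lehmer_surj inv es; have := H t; rewrite et eqxx.
have := @rewriting_mul_top t r; rewrite et => /(_ st).
case: r st => [e' st [u eu /rewriting_eq->]|_ /rewriting_eq->]; last by rewrite eqxx.
case: eqP => [/(congr1 (mcoeff (Psi u)))/eqP|_].
  by rewrite mcoeffX eqxx mcoeff0 oner_eq0.
case: pickP => [v /eqP|/(_ u)]; last by rewrite eqxx.
move=> /(congr1 (mcoeff (Psi u))); rewrite !mcoeffX eqxx.
case: eqP => [/Psi_inj->|_ /eqP]; last by rewrite oner_eq0.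
by rewrite /= eu.
Qed.

End Rewriting.

Lemma eq_tabulate (e : seq nat) n f : size e = n ->
  (forall i, (i < n)%N -> nth 0%N e i = f i.+1) -> e = tabulate n f.
Proof.
move=> en H; apply: (eq_from_nth (x0 := 0%N)); first by rewrite size_map size_iota.
by rewrite en => i ie; rewrite (nth_map 0%N) ?size_iota // nth_iota // H.
Qed.

Lemma size_tabulate n f : size (tabulate n f) = n.
Proof. by rewrite size_map size_iota. Qed.

Lemma nth_tabulate n f i : (i < n)%N -> nth 0%N (tabulate n f) i = f i.+1.
Proof. by move=> ni; rewrite (nth_map 0%N) ?size_iota // nth_iota. Qed.

Lemma step_shift e n : size e = n -> 0%N :: map S e =
  tabulate n.+1 (fun k => if k == 1%N then 0%N else (entry e (k - 1) + 1)%N).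
Proof.
move=> en; apply: eq_tabulate => [|[|i] ie] //=; first by rewrite size_map en.
by rewrite (nth_map 0%N) ?en // /entry subn1 addn1.
Qed.

Theorem proposition3p14 (n : nat) (hn : (2 <= n)%N)
    (d : Order.disp_t) (E : finOrderType d) (hE : #|E| = n) :
  (forall m : hmonomial E, normal m ->
     exists r : hpoly E,
       (forall r' : hpoly E,
          is_rewriting (chow_g [set: E] * g_eval 'X_[m])%R r' <-> r' = r) /\
       (r = 0%R \/ exists2 m' : hmonomial E, normal m' & r = 'X_[m'])) /\
  (forall e : seq nat, is_invseq n e ->
     ((forall i, 2 <= i <= n -> entry e i <> 0) ->
        g_map E e =
          omap (fun r => tabulate n (fun k =>
                  if k == 1 then 0 else entry r (k - 1) + 1))
               (g_map 'I_(n - 1)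
                  (tabulate (n - 1) (fun i => entry e (i + 1) - 1)))) /\
     (entry e n = 0 ->
        g_map E e =
          Some (tabulate n (fun k =>
                  if k == 1 then 0 else entry e (k - 1) + 1))) /\
     (forall k, 2 <= k < n -> entry e k = 0 ->
        (forall j, k < j <= n -> entry e j <> 0) ->
        g_map E e =
          omap (fun r => tabulate n (fun j =>
                  if j <= k - 1 then entry r j else entry e j))
               (g_map 'I_(k - 1) (tabulate (k - 1) (entry e)))))%N.
Proof.
split=> [m /Psi_surj[t ->]|e].
  have [inv sz] := lehmer_invseq t.
  have [|r /rewriting_mul_top] := @step_total (lehmer t) _ inv.
    by rewrite -size_eq0 sz hE; case: n hn {hE}.
  case: r => [e' [u _ H]|H]; [exists 'X_[Psi u]|exists 0%R]; split.
  - by move=> r'; split=> [H'|->//]; apply: is_rewriting_uniq H' H.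
  - by right; exists (Psi u); rewrite // Psi_normal.
  - by move=> r'; split=> [H'|->//]; apply: is_rewriting_uniq H' H.
  - by left.
move=> ne; have /is_invseqP[sz inv] := ne; rewrite -hE in ne.
have e0 : nth 0%N e 0 = 0%N by apply/eqP; rewrite -leqn0 inv.
case: n hn hE sz => [|[|n]] // _ hE sz; rewrite !subn1 /=.
split; [|split] => [pos|en|k /andP[k2 kn] ek pos].
- set e' := tabulate _ _.
  have sz' : size e' = n.+1 by rewrite size_tabulate.
  have ne' i : (i < n.+1)%N -> (nth 0%N e' i).+1 = nth 0%N e i.+1.
    move=> iN; rewrite nth_tabulate // addn1 subn1 prednK // lt0n.
    by apply/eqP; apply: (pos i.+2).
  clearbody e'; have inv' : invseq e'.
    move=> i; have [iN|iN] := ltnP i n.+1; last by rewrite nth_default ?sz'.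
    by rewrite -ltnS ne' // inv.
  have eE : e = 0%N :: map S e'.
    apply: (eq_from_nth (x0 := 0%N)); first by rewrite /= size_map sz' sz.
    rewrite sz => -[|i] iN //=; by rewrite (nth_map 0%N) ?sz' // ne'.
  have e'N : e' != [::] by rewrite -size_eq0 sz'.
  have [r st] := step_total e'N inv'.
  (* [step] mentions no ground set, so the same r computes the map on the smaller ordinal and feeds
     the rule applied on E. *)
  rewrite (@g_map_step _ 'I_n.+1 e' r) // ?card_ord; last by apply/is_invseqP.
  rewrite (g_map_step ne (r := omap (fun e' => 0%N :: map S e') r)); last first.
    by rewrite [X in step X]eE; apply: step_first.
  have := size_step st; case: r {st} => //= r sr.
  by rewrite (step_shift (n := n.+1)) // sr.
- have sz1 : size (take n.+1 e) = n.+1 by rewrite size_takel // sz.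
  have eE : e = rcons (take n.+1 e) 0%N.
    by rewrite -[X in rcons _ X]en -take_nth ?sz // take_oversize ?sz.
  rewrite (g_map_step ne (r := Some (0%N :: map S (take n.+1 e)))); last first.
    by rewrite {1}eE; apply: step_last; rewrite -size_eq0 sz1.
  rewrite (step_shift sz1); congr Some; apply/eq_in_map => i.
  rewrite mem_iota => /andP[i1 iN]; case: eqP => // /eqP i1'.
  rewrite /entry nth_take // subn1.
  by case: i i1 iN i1' => [|[|i]].
(* With k rewritten as [k.+2], the last zero is at position [k.+1] counted from 0, which is also the
   length of [e1]. *)
case: k k2 kn ek pos => [|[|k]] // _ kn ek pos; rewrite /=.
set e1 := tabulate _ _; pose e2 := drop k.+2 e.
have sz1 : size e1 = k.+1 by rewrite size_tabulate.
have e1E : e1 = take k.+1 e.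
  apply: (eq_from_nth (x0 := 0%N)); first by rewrite sz1 size_takel // sz ltnW // ltnW.
  by rewrite sz1 => i ik; rewrite nth_tabulate // nth_take.
have eE : e = e1 ++ 0%N :: e2.
  by rewrite -ek e1E /entry -drop_nth ?cat_take_drop // sz ltnW.
have a2 : all (fun k => k != 0%N) e2.
  apply/(all_nthP 0%N) => i; rewrite size_drop sz ltn_subRL => iN.
  rewrite nth_drop; apply/eqP; apply: (pos (k.+2 + i).+1).
  by rewrite iN andbT ltnS leq_addr.
have e1N : e1 != [::] by rewrite -size_eq0 sz1.
have e2N : e2 != [::] by rewrite -size_eq0 size_drop sz subn_eq0 -ltnNge.
have inv1 : invseq e1.
  move=> i; have [iN|iN] := ltnP i k.+1; last by rewrite nth_default ?sz1.
  by rewrite nth_tabulate // inv.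
clearbody e1; have [r st] := step_total e1N inv1.
rewrite (@g_map_step _ 'I_k.+1 e1 r) // ?card_ord; last by apply/is_invseqP.
rewrite (g_map_step ne (r := omap (fun e' => e' ++ 0%N :: e2) r)); last first.
  by rewrite [X in step X]eE; apply: step_mid.
have := size_step st; case: r {st} => //= r sr; congr Some.
apply: eq_tabulate => [|i iN]; first by rewrite size_cat sr -(size_cat e1) -eE.
rewrite nth_cat sr sz1; case: ltnP => // ik.
by rewrite /entry [in RHS]eE nth_cat sz1 ltnNge ik.
Qed.
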